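(* Let $p$ be a prime and let $R\to S$ be a map of Noetherian $F$-finite (ordinary, commutative) $\mathbf{F}_p$-algebras. Then $R\to S$ is relatively perfect if and only if it is formally étale.
   Context: An $\mathbf{F}_p$-algebra is $F$-finite if its Frobenius endomorphism $F\colon x\mapsto x^p$ is a finite ring map. For a map $R\to S$ of commutative $\mathbf{F}_p$-algebras, $F_*R$ denotes $R$ viewed as an $R$-module via $F$. The map $R\to S$ is relatively perfect if the derived relative Frobenius map $S\otimes^L_{R,F}R\to S$ is an equivalence; equivalently, the relative Frobenius $S\otimes_{R,F}R\to S$, $s\otimes r\mapsto s^pr$, is an isomorphism and $S$ and $F_*R$ are Tor-independent over $R$. Formally étale is meant in the usual sense for the discrete topologies (unique lifting along square-zero thickenings of $R$-algebras). *)

(* Defs.v *)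
From HB Require Import structures.
From mathcomp Require Import all_boot all_algebra.
From mathcomp Require Import boolp.

Set Implicit Arguments.
Unset Strict Implicit.
Unset Printing Implicit Defensive.

Import GRing.Theory.
Local Open Scope ring_scope.
Local Open Scope quotient_scope.

(* All rings are [comPzRingType]s, so the zero ring is allowed.  A commutative
   F_p-algebra is a ring [R] with [p%:R = 0 :> R], and every ring morphism
   between two of these is F_p-linear. *)

Section Frobenius.
Variables (p : nat) (p_pr : prime p) (R : comPzRingType) (pR0 : p%:R = 0 :> R).

Definition frobenius of prime p & p%:R = 0 :> R := fun x : R => x ^+ p.

Local Notation F := (frobenius p_pr pR0).

Fact frobenius_nmod_morphism : nmod_morphism F.
Proof.
have p_gt0 := prime_gt0 p_pr.
split=> [|x y]; rewrite /frobenius; first by rewrite expr0n eqn0Ngt p_gt0.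
rewrite exprDn -(prednK p_gt0) big_ord_recl big_ord_recr /= prednK // subn0.
rewrite bin0 mulr1n mulr1 /bump /= !add1n prednK // subnn binn mul1r mulr1n.
rewrite big1 ?add0r // => i _; rewrite /bump /= add1n -mulr_natr.
have /dvdnP[q ->] : (p %| 'C(p, i.+1))%N.
  by apply: prime_dvd_bin; rewrite //= -ltn_predRL.
by rewrite natrM pR0 !mulr0.
Qed.

Fact frobenius_monoid_morphism : monoid_morphism F.
Proof. by split=> [|x y]; rewrite /frobenius ?expr1n ?exprMn. Qed.

HB.instance Definition _ := GRing.isNmodMorphism.Build R R F
  frobenius_nmod_morphism.
HB.instance Definition _ := GRing.isMonoidMorphism.Build R R F
  frobenius_monoid_morphism.

End Frobenius.

Definition is_ideal (R : comPzRingType) (I : R -> Prop) : Prop :=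
  [/\ I 0, forall x y, I x -> I y -> I (x + y) & forall a x, I x -> I (a * x)].

Definition noetherian (R : comPzRingType) : Prop :=
  forall I : R -> Prop, is_ideal I ->
  exists (n : nat) (g : 'I_n -> R),
    forall x, I x <-> exists c : 'I_n -> R, x = \sum_(i < n) c i * g i.

Definition finite_rmorphism (A B : comPzRingType) (f : {rmorphism A -> B}) :
    Prop :=
  exists (n : nat) (g : 'I_n -> B),
    forall b, exists c : 'I_n -> A, b = \sum_(i < n) f (c i) * g i.

Definition F_finite (p : nat) (p_pr : prime p) (R : comPzRingType)
    (pR0 : p%:R = 0 :> R) : Prop :=
  finite_rmorphism (frobenius p_pr pR0).

(* A square-zero thickening of R-algebras is a surjective map [q : B -> C] of
   R-algebras whose kernel has square zero; [b] and [q \o b] are the structure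
   maps of [B] and [C]. *)
Definition formally_etale (R S : comPzRingType) (f : {rmorphism R -> S}) :
    Prop :=
  forall (B C : comPzRingType) (b : {rmorphism R -> B})
         (q : {rmorphism B -> C}) (u : {rmorphism S -> C}),
    (forall c, exists x, q x = c) ->
    (forall x y, q x = 0 -> q y = 0 -> x * y = 0) ->
    u \o f =1 q \o b ->
  exists v : {rmorphism S -> B},
    [/\ v \o f =1 b, q \o v =1 u
      & forall w : {rmorphism S -> B}, w \o f =1 b -> q \o w =1 u -> w =1 v].

Section RestrictionOfScalars.
Variables (A B : pzRingType) (g : {rmorphism A -> B}) (M : lmodType B).

Definition restr of {rmorphism A -> B} : Type := M.
Local Notation N := (restr g).

HB.instance Definition _ := GRing.Zmodule.copy N M.

Definition restr_scale (a : A) (x : N) : N := g a *: (x : M).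

Fact restr_scaleA a b x :
  restr_scale a (restr_scale b x) = restr_scale (a * b) x.
Proof. by rewrite /restr_scale scalerA rmorphM. Qed.
Fact restr_scale1 : left_id 1 restr_scale.
Proof. by move=> x; rewrite /restr_scale rmorph1 scale1r. Qed.
Fact restr_scaleDr : right_distributive restr_scale +%R.
Proof. by move=> a x y; exact: scalerDr. Qed.
Fact restr_scaleDl x : {morph restr_scale^~ x : a b / a + b}.
Proof. by move=> a b; rewrite /restr_scale rmorphD scalerDl. Qed.

HB.instance Definition _ := GRing.Zmodule_isLmodule.Build A N
  restr_scaleA restr_scale1 restr_scaleDr restr_scaleDl.

End RestrictionOfScalars.
Arguments restr {A B} M g.

Section Tensor.
Variables (R : comPzRingType) (M N : lmodType R).

(* [M (x)_R N] is the commutative monoid generated by the symbols [m (x) n],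
   modulo the bilinear relations; the symbol [(- m) (x) n] is an inverse of
   [m (x) n], so that this is a group.  A formal sum of generators is a list. *)
Inductive tens_rel : seq (M * N) -> seq (M * N) -> Prop :=
| TensRefl s : tens_rel s s
| TensSym s t : tens_rel s t -> tens_rel t s
| TensTrans s t u : tens_rel s t -> tens_rel t u -> tens_rel s u
| TensCat s s' t t' :
    tens_rel s s' -> tens_rel t t' -> tens_rel (s ++ t) (s' ++ t')
| TensCatC s t : tens_rel (s ++ t) (t ++ s)
| TensDl m m' n : tens_rel [:: (m + m', n)] [:: (m, n); (m', n)]
| TensDr m n n' : tens_rel [:: (m, n + n')] [:: (m, n); (m, n')]
| TensZ a m n : tens_rel [:: (a *: m, n)] [:: (m, a *: n)]
| Tens0 n : tens_rel [:: (0, n)] [::].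

Definition tens_relb : rel (seq (M * N)) := fun s t => `[< tens_rel s t >].

Fact tens_relb_refl : reflexive tens_relb.
Proof. by move=> s; apply/asboolP; exact: TensRefl. Qed.
Fact tens_relb_sym : symmetric tens_relb.
Proof. by move=> s t; apply/asboolP/asboolP; exact: TensSym. Qed.
Fact tens_relb_trans : transitive tens_relb.
Proof.
by move=> t s u /asboolP st /asboolP tu; apply/asboolP/(TensTrans st).
Qed.

Canonical tens_equiv :=
  EquivRel tens_relb tens_relb_refl tens_relb_sym tens_relb_trans.

Definition tensor : Type := {eq_quot tens_equiv}.
HB.instance Definition _ := Choice.on tensor.
HB.instance Definition _ := EqQuotient.on tensor.

Lemma tens_eqP s t : \pi_tensor s = \pi_tensor t <-> tens_rel s t.
Proof. by split=> [/eqmodP/asboolP|st]; [|apply/eqmodP/asboolP]. Qed.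

Lemma tens_reprP s : tens_rel (repr (\pi_tensor s)) s.
Proof. by apply/tens_eqP; rewrite reprK. Qed.

Lemma tensorW (P : tensor -> Prop) :
  (forall s, P (\pi_tensor s)) -> forall x, P x.
Proof. by move=> Ppi x; rewrite -[x]reprK. Qed.

Definition tens (m : M) (n : N) : tensor := \pi_tensor [:: (m, n)].

Definition tens_scale (a : R) (s : seq (M * N)) :=
  [seq (a *: x.1, x.2) | x <- s].

Lemma tens_rel_scale a s t :
  tens_rel s t -> tens_rel (tens_scale a s) (tens_scale a t).
Proof.
elim=> {s t} /=.
- by move=> s; exact: TensRefl.
- by move=> s t _; exact: TensSym.
- by move=> s t u _ st _; exact: TensTrans.
- by move=> s s' t t' _ ss' _ tt'; rewrite /tens_scale !map_cat; exact: TensCat.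
- by move=> s t; rewrite /tens_scale !map_cat; exact: TensCatC.
- by move=> m m' n; rewrite scalerDr; exact: TensDl.
- by move=> m n n'; exact: TensDr.
- by move=> b m n; rewrite scalerA mulrC -scalerA; exact: TensZ.
- by move=> n; rewrite scaler0; exact: Tens0.
Qed.

Definition tensor_zero : tensor := \pi_tensor [::].
Definition tensor_add (x y : tensor) : tensor := \pi_tensor (repr x ++ repr y).
Definition tensor_scale (a : R) (x : tensor) : tensor :=
  \pi_tensor (tens_scale a (repr x)).

Lemma tensor_addE s t :
  tensor_add (\pi_tensor s) (\pi_tensor t) = \pi_tensor (s ++ t).
Proof. by apply/tens_eqP/TensCat; exact: tens_reprP. Qed.

Lemma tensor_scaleE a s :
  tensor_scale a (\pi_tensor s) = \pi_tensor (tens_scale a s).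
Proof. by apply/tens_eqP/tens_rel_scale; exact: tens_reprP. Qed.

Fact tensor_addA : associative tensor_add.
Proof.
elim/tensorW=> s; elim/tensorW=> t; elim/tensorW=> u.
by rewrite !tensor_addE catA.
Qed.
Fact tensor_addC : commutative tensor_add.
Proof.
elim/tensorW=> s; elim/tensorW=> t; rewrite !tensor_addE.
by apply/tens_eqP/TensCatC.
Qed.
Fact tensor_add0 : left_id tensor_zero tensor_add.
Proof. by elim/tensorW=> s; rewrite tensor_addE. Qed.
Fact tensor_scaleDl x :
  {morph tensor_scale^~ x : a b / a + b >-> tensor_add a b}.
Proof.
elim/tensorW: x => s a b; rewrite !tensor_scaleE tensor_addE; apply/tens_eqP.
elim: s => [|[m n] s IHs] /=; first exact: TensRefl.
rewrite scalerDl; apply: TensTrans.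
  exact: (@TensCat [:: _] _ _ _ (TensDl _ _ n) IHs).
apply: (@TensCat [:: _] [:: _]); first exact: TensRefl.
rewrite -[X in tens_rel X _]cat1s -[X in tens_rel _ (_ ++ X)]cat1s !catA.
by apply: TensCat (TensRefl _); exact: TensCatC.
Qed.
Fact tensor_scale0 x : tensor_scale 0 x = tensor_zero.
Proof.
elim/tensorW: x => s; rewrite tensor_scaleE; apply/tens_eqP.
elim: s => [|[m n] s IHs] /=; first exact: TensRefl.
by rewrite scale0r; apply: (@TensCat [:: _] [::] _ [::]) => //; exact: Tens0.
Qed.
Fact tensor_scale1 : left_id 1 tensor_scale.
Proof.
elim/tensorW=> s; rewrite tensor_scaleE /tens_scale.
congr (\pi_tensor _); rewrite -[RHS]map_id.
by apply: eq_map => -[m n]; rewrite scale1r.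
Qed.
Fact tensor_scaleA a b x :
  tensor_scale a (tensor_scale b x) = tensor_scale (a * b) x.
Proof.
elim/tensorW: x => s; rewrite !tensor_scaleE /tens_scale -map_comp.
by congr (\pi_tensor _); apply: eq_map => x /=; rewrite scalerA.
Qed.
Fact tensor_scaleDr a x y :
  tensor_scale a (tensor_add x y)
  = tensor_add (tensor_scale a x) (tensor_scale a y).
Proof.
elim/tensorW: x => s; elim/tensorW: y => t.
by rewrite tensor_addE !tensor_scaleE tensor_addE /tens_scale map_cat.
Qed.
Fact tensor_addN : left_inverse tensor_zero (tensor_scale (- 1)) tensor_add.
Proof.
by move=> x; rewrite -[X in tensor_add _ X]tensor_scale1 -tensor_scaleDl addNr
  tensor_scale0.
Qed.

HB.instance Definition _ := GRing.isZmodule.Build tensor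
  tensor_addA tensor_addC tensor_add0 tensor_addN.
HB.instance Definition _ := GRing.Zmodule_isLmodule.Build R tensor
  tensor_scaleA tensor_scale1 tensor_scaleDr tensor_scaleDl.

(* The additive map [M (x)_R N -> V] induced by a biadditive R-balanced map
   [b]; it is only meaningful for such [b], see [tens_lift_tens]. *)
Definition tens_lift (V : zmodType) (b : M -> N -> V) (t : tensor) : V :=
  \sum_(x <- repr t) b x.1 x.2.

Definition balanced (V : zmodType) (b : M -> N -> V) : Prop :=
  [/\ forall m m' n, b (m + m') n = b m n + b m' n,
      forall m n n', b m (n + n') = b m n + b m n'
    & forall a m n, b (a *: m) n = b m (a *: n)].

Lemma tens_lift_pi (V : zmodType) (b : M -> N -> V) s : balanced b ->
  tens_lift b (\pi_tensor s) = \sum_(x <- s) b x.1 x.2.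
Proof.
case=> bDl bDr bZ; rewrite /tens_lift.
move: (repr _) (tens_reprP s) => t; elim=> {s t} //=.
- by move=> ? ? ? _ -> _ ->.
- by move=> ? ? ? ? _ + _; rewrite !big_cat /= => -> ->.
- by move=> ? ?; rewrite !big_cat /= addrC.
- by move=> *; rewrite !big_cons !big_nil /= !addr0 bDl.
- by move=> *; rewrite !big_cons !big_nil /= !addr0 bDr.
- by move=> *; rewrite !big_cons !big_nil /= bZ.
- move=> n; rewrite !big_cons !big_nil /= addr0.
  by apply: (addrI (b 0 n)); rewrite -bDl !addr0.
Qed.

Lemma tens_lift_tens (V : zmodType) (b : M -> N -> V) m n : balanced b ->
  tens_lift b (tens m n) = b m n.
Proof. by move=> bP; rewrite tens_lift_pi // big_seq1. Qed.

Lemma tens_liftD (V : zmodType) (b : M -> N -> V) : balanced b ->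
  {morph tens_lift b : x y / x + y}.
Proof.
move=> bP; elim/tensorW=> s; elim/tensorW=> t; rewrite [_ + _]tensor_addE.
by rewrite !tens_lift_pi // big_cat.
Qed.

Lemma tens_balanced : balanced tens.
Proof.
split=> *; rewrite /tens; last by apply/tens_eqP; exact: TensZ.
  by rewrite [RHS]tensor_addE; apply/tens_eqP; exact: TensDl.
by rewrite [RHS]tensor_addE; apply/tens_eqP; exact: TensDr.
Qed.

End Tensor.

Section TensorMap.
Variables (R : comPzRingType) (P Q : lmodType R) (d : {linear P -> Q}).
Variable N : lmodType R.

Definition tens_map : tensor P N -> tensor Q N :=
  tens_lift (fun m n => tens (d m) n).

Lemma tens_map_balanced : balanced (fun (m : P) (n : N) => tens (d m) n).
Proof.
have [tDl tDr tZ] := tens_balanced Q N.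
by split=> *; rewrite ?linearD ?linearZ ?tDl ?tDr ?tZ.
Qed.

Lemma tens_mapE m n : tens_map (tens m n) = tens (d m) n.
Proof. exact: tens_lift_tens tens_map_balanced. Qed.

End TensorMap.
Arguments tens_map {R P Q} d N t.

Definition projective (R : pzRingType) (P : lmodType R) : Prop :=
  forall (M N : lmodType R) (q : {linear M -> N}) (h : {linear P -> N}),
    (forall y, exists x, q x = y) ->
  exists k : {linear P -> M}, q \o k =1 h.

Record proj_resolution (R : pzRingType) (M : lmodType R) := ProjResolution {
  res_obj : nat -> lmodType R;
  res_d : forall n, {linear res_obj n.+1 -> res_obj n};
  res_aug : {linear res_obj 0 -> M};
  res_projective : forall n, projective (res_obj n);
  res_aug_surj : forall x, exists y, res_aug y = x;
  res_exact0 : forall x, res_aug x = 0 <-> exists y, res_d 0 y = x;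
  res_exact : forall n x, res_d n x = 0 <-> exists y, res_d n.+1 y = x
}.

(* [Tor_i^R(M, N) = 0] for all [i = n.+1 > 0], where [Tor_i^R(M, N)] is the
   homology in degree [i] of [P (x)_R N] for a projective resolution [P] of
   [M]. *)
Definition tor_independent (R : comPzRingType) (M N : lmodType R) : Prop :=
  forall (P : proj_resolution M) (n : nat) (t : tensor (res_obj P n.+1) N),
    tens_map (res_d P n) N t = 0 ->
  exists u : tensor (res_obj P n.+2) N, tens_map (res_d P n.+1) N u = t.

Section RelativelyPerfect.
Variables (p : nat) (p_pr : prime p) (R S : comPzRingType).
Variables (pR0 : p%:R = 0 :> R) (pS0 : p%:R = 0 :> S) (f : {rmorphism R -> S}).

(* [S] and [F_* R] as R-modules, via [f] and the Frobenius of [R]. *)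
Local Notation S_R := (restr S^o f).
Local Notation FR := (restr R^o (frobenius p_pr pR0)).

Definition rel_frobenius_fun (s : S_R) (r : FR) : S :=
  frobenius p_pr pS0 s * f r.

Lemma rel_frobenius_balanced : balanced rel_frobenius_fun.
Proof.
rewrite /rel_frobenius_fun; split=> [s s' r|s r r'|a s r].
- by rewrite raddfD mulrDl.
- by rewrite raddfD mulrDr.
- rewrite /frobenius [a *: s]/(f a * s) [a *: r]/(a ^+ p * r).
  by rewrite exprMn rmorphM rmorphXn mulrAC mulrC.
Qed.

Definition rel_frobenius : tensor S_R FR -> S := tens_lift rel_frobenius_fun.

Lemma rel_frobeniusE s r : rel_frobenius (tens s r) = s ^+ p * f r.
Proof. exact: tens_lift_tens rel_frobenius_balanced. Qed.

(* A ring morphism is an isomorphism if and only if it is bijective; only the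
   map underlying the relative Frobenius is needed. *)
Definition relatively_perfect : Prop :=
  bijective rel_frobenius /\ tor_independent S_R FR.

End RelativelyPerfect.

(* Main.v *)
(* Formally etale follows from the bijectivity of the relative Frobenius alone:
   for a square-zero thickening [q : B -> C] the Frobenius of [B] factors as
   [phi \o q], so that [s (x) r |-> phi (u s) * b r] is the only possible lift
   of [u : S -> C].

   Conversely, let [f : R -> S] be formally etale and [A := S (x)_{R,F} R].
   Elements of the kernels of [S (x)_A S -> S] and of [A -> S] have zero p-th
   power.  Both kernels [J] satisfy [J = J^2], because two maps of R-algebras
   out of [S] that agree modulo [J] agree modulo [J^2]; by noetherianity they
   vanish.  So [A -> S] is an injective finite epimorphism, hence bijective.

   For Tor-independence, [S] is flat over [R] by the equational criterion.  Let
   [m] be a prime of [S], lying over [P] in [R].  Over the field of fractions of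
   [R / P] a relation with coefficients in [R] between elements of [S] comes
   from relations in [R].  The isomorphism [A = S] transports this along the
   Frobenius, from congruences modulo the Frobenius power [P^[q]] to congruences
   modulo [P^[pq]].  The Artin-Rees lemma in [R] and Krull's intersection
   theorem in [S] turn the congruences for all [q] into an equality, locally
   at [m]. *)

From HB Require Import structures.
Require Import Defs.
From mathcomp Require Import all_boot all_algebra ring.
From mathcomp Require Import boolp functions.

Set Implicit Arguments.
Unset Strict Implicit.
Unset Printing Implicit Defensive.

Import GRing.Theory.
Local Open Scope ring_scope.

(** * Linear relations and tensor products *)

(** For a submodule [K] of R^X this is membership in the image of K (x) M in M^X. Any finite type
    may index the sum, so that adding two families is a disjoint union of index types. *)
Definition mspan (R : pzRingType) (M : lmodType R) (X : Type)
    (K : (X -> R) -> Prop) (v : X -> M) : Prop :=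
  exists (L : finType) (k : L -> X -> R) (u : L -> M),
    (forall l, K (k l)) /\ forall x, v x = \sum_l k l x *: u l.

Section MSpan.
Variables (R : comPzRingType) (M : lmodType R).
Implicit Types (X : Type) (I : finType).

Lemma mspan0 X (K : (X -> R) -> Prop) : mspan K (fun=> 0 : M).
Proof.
exists void, (fun=> fun=> 0), (fun=> 0).
by split=> [[]|x]; rewrite big1 // => -[].
Qed.

Lemma mspan1 X (K : (X -> R) -> Prop) k (u : M) :
  K k -> mspan K (fun x => k x *: u).
Proof.
by move=> Kk; exists unit, (fun=> k), (fun=> u); split=> // x;
  rewrite (big_pred1 tt) // => -[].
Qed.

Lemma mspanD X (K : (X -> R) -> Prop) (v w : X -> M) :
  mspan K v -> mspan K w -> mspan K (fun x => v x + w x).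
Proof.
case=> L [k] [u] [Kk vE] [L'] [k'] [u'] [Kk' wE].
exists (L + L')%type, (fun l => match l with inl a => k a | inr b => k' b end),
  (fun l => match l with inl a => u a | inr b => u' b end).
by split=> [[]//|x]; rewrite big_sumType /= vE wE.
Qed.

Lemma mspan_ext X (K : (X -> R) -> Prop) (v w : X -> M) :
  v =1 w -> mspan K v -> mspan K w.
Proof. by move=> /funext->. Qed.

Lemma mspan_sum X (K : (X -> R) -> Prop) (T : Type) (s : seq T)
    (v : T -> X -> M) :
  (forall t, mspan K (v t)) -> mspan K (fun x => \sum_(t <- s) v t x).
Proof.
move=> Kv; elim: s => [|t s IH].
  by apply: mspan_ext (mspan0 K) => x; rewrite big_nil.
by apply: mspan_ext (mspanD (Kv t) IH) => x; rewrite big_cons.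
Qed.

Lemma mspanN X (K : (X -> R) -> Prop) (v : X -> M) :
  mspan K v -> mspan K (fun x => - v x).
Proof.
case=> L [k] [u] [Kk vE]; exists L, k, (fun l => - u l); split=> // x.
by rewrite vE -sumrN; apply: eq_bigr => l _; rewrite scalerN.
Qed.

Lemma mspan_mono X (K K' : (X -> R) -> Prop) (v : X -> M) :
  (forall k, K k -> K' k) -> mspan K v -> mspan K' v.
Proof. by move=> KK' [L [k [u [Kk vE]]]]; exists L, k, u; split=> // l;
  apply: KK'. Qed.

Definition sol I X (A : X -> I -> R) : (I -> R) -> Prop :=
  fun k => forall x, \sum_i A x i * k i = 0.

(** The equational criterion for flatness, for finite systems; it serves as the definition of
    flatness throughout. *)
Definition equationally_flat : Prop :=
  forall (I X : finType) (A : X -> I -> R) (v : I -> M),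
    (forall x, \sum_i A x i *: v i = 0) -> mspan (sol A) v.

End MSpan.

Section TensorVanishing.
Variables (R : comPzRingType) (M N : lmodType R) (I : finType) (g : I -> N).
Hypothesis gP : forall n, exists c : I -> R, n = \sum_i c i *: g i.

Definition rel_of : (I -> R) -> Prop := fun k => \sum_i k i *: g i = 0.

Lemma tens0l (n : N) : tens (0 : M) n = 0.
Proof. by case: (tens_balanced M N) => tD _ _; apply: (addrI (tens 0 n));
  rewrite -tD !addr0. Qed.

Lemma tens0r (m : M) : tens m (0 : N) = 0.
Proof. by case: (tens_balanced M N) => _ tD _; apply: (addrI (tens m 0));
  rewrite -tD !addr0. Qed.

Lemma tens_suml (T : Type) (s : seq T) (F : T -> M) (n : N) :
  tens (\sum_(t <- s) F t) n = \sum_(t <- s) tens (F t) n.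
Proof.
case: (tens_balanced M N) => tD _ _.
by elim: s => [|t s IH]; rewrite ?big_nil ?tens0l // !big_cons tD IH.
Qed.

Lemma tens_sumr (T : Type) (s : seq T) (F : T -> N) (m : M) :
  tens m (\sum_(t <- s) F t) = \sum_(t <- s) tens m (F t).
Proof.
case: (tens_balanced M N) => _ tD _.
by elim: s => [|t s IH]; rewrite ?big_nil ?tens0r // !big_cons tD IH.
Qed.

Lemma tens_piE (s : seq (M * N)) :
  \pi_(tensor M N)%qT s = \sum_(x <- s) tens x.1 x.2.
Proof.
elim: s => [|[m n] s IH]; first by rewrite big_nil.
by rewrite big_cons -IH /tens [RHS]tensor_addE.
Qed.

Lemma tensor_ind (P : tensor M N -> Prop) :
  P 0 -> (forall x y, P x -> P y -> P (x + y)) -> (forall m n, P (tens m n)) ->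
  forall x, P x.
Proof.
move=> P0 PD Pt; elim/tensorW => s; rewrite tens_piE.
by elim: s => [|[m n] s IH]; rewrite ?big_nil // big_cons; apply: PD.
Qed.

Lemma tens_lift0 (V : zmodType) (b : M -> N -> V) :
  balanced b -> tens_lift b 0 = 0.
Proof. by move=> /tens_lift_pi bE; rewrite [LHS]bE big_nil. Qed.

Lemma tens_lift_sum (V : zmodType) (b : M -> N -> V) (T : Type) (s : seq T)
    (y : T -> M) (n : T -> N) : balanced b ->
  tens_lift b (\sum_(t <- s) tens (y t) (n t)) = \sum_(t <- s) b (y t) (n t).
Proof.
move=> bal; rewrite (big_morph _ (tens_liftD bal) (tens_lift0 bal)).
by apply: eq_bigr => t _; rewrite tens_lift_tens.
Qed.

Lemma tensor_gen (t : tensor M N) :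
  exists z : I -> M, t = \sum_i tens (z i) (g i).
Proof.
case: (tens_balanced M N) => tDl _ tZ.
elim/tensor_ind: t => [|_ _ [z ->] [z' ->]|m n].
- by exists (fun=> 0); rewrite big1 // => i _; rewrite tens0l.
- exists (fun i => z i + z' i).
  by rewrite -big_split; apply: eq_bigr => i _; rewrite tDl.
- have [c ->] := gP n; exists (fun i => c i *: m).
  by rewrite tens_sumr; apply: eq_bigr => i _; rewrite tZ.
Qed.

Lemma tens_mspan_rel (y : I -> M) :
  mspan rel_of y -> \sum_i tens (y i) (g i) = 0.
Proof.
case: (tens_balanced M N) => _ _ tZ.
case=> L [k] [u] [Kk yE].
under eq_bigr do rewrite yE tens_suml.
rewrite exchange_big /= big1 // => l _.
under eq_bigr do rewrite tZ.
by rewrite -tens_sumr [X in tens _ X]Kk tens0r.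
Qed.

(** Choosing coordinates [c] for every element of [N] turns a formal sum [s] of tensors into a
    family [vec s] in M^I. Each defining relation of the tensor product changes this family only by
    relations between the [g i]. *)
Lemma tens_sum_eq0 (y : I -> M) :
  \sum_i tens (y i) (g i) = 0 -> mspan rel_of y.
Proof.
have [c cP] := choice gP.
pose vec (s : seq (M * N)) i := \sum_(x <- s) c x.2 i *: x.1.
have vec_cat s t i : vec (s ++ t) i = vec s i + vec t i by rewrite /vec big_cat.
have vec0 i : vec [::] i = 0 by rewrite /vec big_nil.
have vec_cons x s i : vec (x :: s) i = c x.2 i *: x.1 + vec s i.
  by rewrite /vec big_cons.
have relV s t : tens_rel s t -> mspan rel_of (fun i => vec s i - vec t i).
  elim=> {s t}.
  - by move=> s; apply: mspan_ext (mspan0 M _) => i; rewrite subrr.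
  - by move=> s t _ /mspanN; apply: mspan_ext => i; rewrite opprB.
  - move=> s t u _ H1 _ H2; apply: mspan_ext (mspanD H1 H2) => i.
    by rewrite addrA subrK.
  - move=> s s' t t' _ H1 _ H2; apply: mspan_ext (mspanD H1 H2) => i.
    by rewrite !vec_cat opprD addrACA.
  - move=> s t; apply: mspan_ext (mspan0 M _) => i.
    by rewrite !vec_cat [X in X - _]addrC subrr.
  - move=> m m' n; apply: mspan_ext (mspan0 M _) => i.
    by rewrite !vec_cons vec0 !addr0 scalerDr subrr.
  - move=> m n n'.
    have Kk : rel_of (fun i => c (n + n') i - c n i - c n' i).
      rewrite /rel_of.
      under eq_bigr do rewrite !scalerBl.
      by rewrite !sumrB -!cP addrAC addrK subrr.
    apply: mspan_ext (mspan1 m Kk) => i.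
    by rewrite !vec_cons vec0 !addr0 !scalerBl opprD addrA.
  - move=> a m n.
    have Kk : rel_of (fun i => a * c n i - c (a *: n) i).
      rewrite /rel_of.
      under eq_bigr do rewrite scalerBl -scalerA.
      by rewrite sumrB -scaler_sumr -!cP subrr.
    apply: mspan_ext (mspan1 m Kk) => i.
    by rewrite !vec_cons vec0 !addr0 scalerBl scalerA mulrC.
  - move=> n; apply: mspan_ext (mspan0 M _) => i.
    by rewrite vec_cons !vec0 scaler0 addr0 subrr.
move=> y0.
have {y0} /relV yV : tens_rel [seq (y i, g i) | i <- index_enum I] [::].
  by apply/tens_eqP; rewrite !tens_piE big_map big_nil.
(* The chosen coordinates of [g j] differ from the j-th unit vector by a relation; this correction
   turns [vec] of the formal sum into [y]. *)
have Kk j : rel_of (fun i => (i == j)%:R - c (g j) i).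
  rewrite /rel_of.
  under eq_bigr do rewrite scalerBl.
  rewrite sumrB -cP (bigD1 j) //= eqxx scale1r big1 ?addr0 ?subrr //.
  by move=> i /negPf->; rewrite scale0r.
have := mspan_sum (index_enum I) (fun j => mspan1 (y j) (Kk j)).
move=> /(mspanD yV); apply: mspan_ext => i.
under [X in _ + X]eq_bigr do rewrite scalerBl.
rewrite /vec big_map big_nil /= subr0 sumrB addrC subrK.
rewrite (bigD1 i) //= eqxx scale1r big1 ?addr0 // => j /negPf.
by rewrite eq_sym => ->; rewrite scale0r.
Qed.

End TensorVanishing.

(** * Projective modules are flat *)

Section FreeModule.
Variables (R : comPzRingType) (T : choiceType).

Definition fin_supp : {pred T -> R^o} :=
  fun h => `[< exists s : seq T, forall x, x \notin s -> h x = 0 >].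

Fact fin_supp_submod : submod_closed fin_supp.
Proof.
split=> [|a h h' /asboolP[s sP] /asboolP[s' sP']]; apply/asboolP.
  by exists [::].
exists (s ++ s') => x; rewrite mem_cat negb_or => /andP[xs xs'].
by rewrite addrfctE scalrfctE sP // sP' // addr0 scaler0.
Qed.

HB.instance Definition _ :=
  GRing.isSubmodClosed.Build R (T -> R^o) fin_supp fin_supp_submod.

Record free := Free { free_val :> T -> R^o; _ : free_val \in fin_supp }.
HB.instance Definition _ := [isSub for free_val].
HB.instance Definition _ := [Choice of free by <:].
HB.instance Definition _ := [SubChoice_isSubLmodule of free by <:].

Lemma free_supp (h : free) : exists s : seq T, forall x, x \notin s -> h x = 0.
Proof. by case: h => h /= /asboolP. Qed.

End FreeModule.

Section FreeCover.
Variables (R : comPzRingType) (P : lmodType R).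

Definition supported (h : P -> R) (s : seq P) := forall x,
  x \notin s -> h x = 0.

Lemma supported_sum (h : P -> R) (s s' : seq P) :
  supported h s -> supported h s' ->
  \sum_(x <- undup s) h x *: x = \sum_(x <- undup s') h x *: x.
Proof.
move=> hs hs'.
have E (r : seq P) :
    \sum_(x <- r) h x *: x = \sum_(x <- [seq x <- r | h x != 0]) h x *: x.
  rewrite big_filter [LHS](bigID (fun x => h x == 0)) /= big1 ?add0r //.
  by move=> x /eqP->; rewrite scale0r.
rewrite (E (undup s)) (E (undup s')); apply: perm_big.
apply: uniq_perm; rewrite ?filter_uniq ?undup_uniq // => x.
rewrite !mem_filter !mem_undup; case: eqP => //= /eqP hx.
by apply/idP/idP => xs; apply: contraNT hx => xs';
  rewrite ?(hs _ xs') ?(hs' _ xs').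
Qed.

(** The canonical surjection from the free module on the set [P]. The sum runs over a chosen
    support, with repetitions removed; [free_combE] frees it from the choice. *)
Definition free_comb (h : free R P) : P :=
  \sum_(x <- undup (sval (cid (free_supp h)))) h x *: x.

Lemma free_combE (h : free R P) s : supported h s ->
  free_comb h = \sum_(x <- undup s) h x *: x.
Proof. by move=> hs; apply: supported_sum hs; case: cid. Qed.

Fact free_comb_linear : linear free_comb.
Proof.
move=> a h h'.
have [s hs] := free_supp h; have [s' hs'] := free_supp h'.
have sD (g : P -> R) r r' : supported g r \/ supported g r' ->
  supported g (r ++ r').
  by move=> H x; rewrite mem_cat negb_or => /andP[xr xr']; case: H => -> .
rewrite (@free_combE h (s ++ s')) ?(@free_combE h' (s ++ s'));
  try by apply: sD; auto.
rewrite (@free_combE _ (s ++ s')).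
  rewrite scaler_sumr -big_split /=; apply: eq_bigr => x _.
  by transitivity ((a * h x + h' x) *: x); rewrite // scalerDl scalerA.
move=> x; rewrite mem_cat negb_or => /andP[xs xs'].
by rewrite -[LHS]/(a * h x + h' x) hs // hs' // mulr0 addr0.
Qed.

HB.instance Definition _ :=
  GRing.isLinear.Build R (free R P) P _ free_comb free_comb_linear.

Lemma free_comb_surj (x : P) : exists h, free_comb h = x.
Proof.
have dP : (fun y : P => (y == x)%:R : R) \in @fin_supp R P.
  by apply/asboolP; exists [:: x] => y; rewrite inE => /negPf->.
exists (Free dP); rewrite (@free_combE _ [:: x]).
  by rewrite /= big_seq1 /= eqxx scale1r.
by move=> y; rewrite inE /= => /negPf->.
Qed.

(** Projectivity splits the cover of [P] by the free module on its elements. The coordinates of the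
    section [k] solve every system that [v] solves, and each [v i] is the combination of basis
    elements with these coordinates. *)
Lemma projective_flat : projective P -> equationally_flat P.
Proof.
move=> Pproj I X A v Av.
have [k kP] := Pproj (free R P) P free_comb idfun free_comb_surj.
have [s sP] : exists s : seq P, forall i, supported (k (v i)) s.
  have [f fP] := choice (fun i => free_supp (k (v i))).
  exists (flatten [seq f i | i <- enum I]) => i x xs; apply: fP.
  by apply: contra xs => xs; apply/flatten_mapP; exists i; rewrite ?mem_enum.
apply: mspan_ext (mspan_sum (undup s) (v := fun x i => k (v i) x *: x) _) =>
  [i|x].
  by rewrite -free_combE //; apply: kP.
apply: mspan1 => a.
have := congr1 (fun h : free R P => h x) (congr1 k (Av a)).
have kD : {morph (fun h : free R P => h x) : g h / g + h} by [].
rewrite linear0 linear_sum /= => Ex; rewrite -[RHS]Ex.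
rewrite (big_morph (fun h : free R P => h x) kD (erefl _)).
by apply: eq_bigr => i _; rewrite linearZ.
Qed.
End FreeCover.

(** * Vanishing of Tor for a flat module *)

Section TorVanishing.
Variable R : comPzRingType.

(** Flatness of the image of [d], phrased with preimages in [P] so that the image never has to be
    built as a module. *)
Definition flat_image (P Q : lmodType R) (d : {linear P -> Q}) : Prop :=
  forall (I X : finType) (A : X -> I -> R) (v : I -> P),
    (forall x, \sum_i A x i *: d (v i) = 0) ->
  exists (L : finType) (k : L -> I -> R) (u : L -> P),
    (forall l, sol A (k l)) /\ forall i, d (v i) = \sum_l k l i *: d (u l).

Lemma flat_image_surj (P Q : lmodType R) (d : {linear P -> Q}) :
  (forall y, exists x, d x = y) -> equationally_flat Q -> flat_image d.
Proof.
move=> d_surj Qflat I X A v /Qflat[L [k [w [Kk vE]]]].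
have [u uE] := choice (fun l => d_surj (w l)).
by exists L, k, u; split=> // i; rewrite vE; under [RHS]eq_bigr do rewrite uE.
Qed.

(** Express d (v i) in [P0] through solutions [k] and elements [y]. The e (y l) satisfy the
    relations [k], so flatness expresses them through e (u l') with coefficients [c]. Subtracting
    the same combinations of [u] moves [y] into the image of [d], and leaves the sums unchanged
    because the rows of [k] kill [c]. *)
Lemma flat_image_step (P1 P0 Q : lmodType R) (d : {linear P1 -> P0})
    (e : {linear P0 -> Q}) :
  (forall x, e x = 0 <-> exists y, d y = x) ->
  equationally_flat P0 -> flat_image e -> flat_image d.
Proof.
move=> exact_de P0flat eflat I X A v /P0flat[L [k [y [Kk vE]]]].
have /eflat[L' [c [u [Kc yE]]]] : forall i, \sum_l k l i *: e (y l) = 0.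
  move=> i; have /exact_de : exists z, d z = d (v i) by exists (v i).
  by rewrite vE linear_sum; under eq_bigr do rewrite linearZ.
have /choice[t tE] l : exists t, d t = y l - \sum_l' c l' l *: u l'.
  apply/exact_de; rewrite linearB linear_sum /= yE.
  by under [X in _ - X]eq_bigr do rewrite linearZ; rewrite subrr.
exists L, k, t; split=> // i; rewrite vE.
under [RHS]eq_bigr do rewrite tE scalerBr scaler_sumr.
rewrite sumrB exchange_big /= [X in _ - X]big1 ?subr0 // => l' _.
under eq_bigr do rewrite scalerA.
by rewrite -scaler_suml Kc scale0r.
Qed.

Lemma tens_map_sum (P Q N : lmodType R) (d : {linear P -> Q}) (I : finType)
    (z : I -> P) (g : I -> N) :
  tens_map d N (\sum_i tens (z i) (g i)) = \sum_i tens (d (z i)) (g i).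
Proof. exact: tens_lift_sum (tens_map_balanced d N). Qed.

(** A tensor killed by [d1] has d1 (z i) spanned by relations [a] between the [g i]. The correction
    of [flat_image_step] puts the spanning elements in the image of [d1], with preimages [s].
    Subtracting the combinations of [s] from [z] keeps the tensor and moves [z] into the kernel of
    [d1]. *)
Lemma flat_image_exact (P2 P1 P0 Q N : lmodType R) (I : finType) (g : I -> N)
    (d2 : {linear P2 -> P1}) (d1 : {linear P1 -> P0}) (e : {linear P0 -> Q}) :
  (forall n, exists c : I -> R, n = \sum_i c i *: g i) ->
  (forall x, d1 x = 0 <-> exists y, d2 y = x) ->
  (forall x, e x = 0 <-> exists y, d1 y = x) ->
  flat_image e ->
  forall t : tensor P1 N, tens_map d1 N t = 0 ->
  exists u : tensor P2 N, tens_map d2 N u = t.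
Proof.
move=> gP exact21 exact10 eflat t; have [z ->] := tensor_gen gP t.
rewrite tens_map_sum => /(tens_sum_eq0 gP)[L [a [y [Ka dzE]]]].
have /eflat[L' [b [u [Kb yE]]]] : forall i, \sum_l a l i *: e (y l) = 0.
  move=> i; have /exact10 : exists w, d1 w = d1 (z i) by exists (z i).
  by rewrite dzE linear_sum; under eq_bigr do rewrite linearZ.
have /choice[s sE] l : exists s, d1 s = y l - \sum_l' b l' l *: u l'.
  apply/exact10; rewrite linearB linear_sum /= yE.
  by under [X in _ - X]eq_bigr do rewrite linearZ; rewrite subrr.
have /choice[w wE] i : exists w, d2 w = z i - \sum_l a l i *: s l.
  apply/exact21; rewrite linearB linear_sum /= dzE.
  under [X in _ - X]eq_bigr do rewrite linearZ /= sE scalerBr scaler_sumr.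
  rewrite sumrB opprB addrC -addrA addNr addr0 exchange_big big1 // => l' _.
  under eq_bigr do rewrite scalerA.
  by rewrite -scaler_suml Kb scale0r.
exists (\sum_i tens (w i) (g i)); rewrite tens_map_sum.
have rel0 : \sum_i tens (\sum_l a l i *: s l) (g i) = 0.
  by apply: tens_mspan_rel; exists L, a, s.
case: (tens_balanced P1 N) => tD _ _.
rewrite -[LHS]addr0 -[X in _ + X]rel0 -big_split; apply: eq_bigr => i _.
by rewrite /= -tD wE subrK.
Qed.

Lemma flat_tor_independent (M N : lmodType R) (I : finType) (g : I -> N) :
  (forall n, exists c : I -> R, n = \sum_i c i *: g i) ->
  equationally_flat M -> tor_independent M N.
Proof.
move=> gP Mflat P.
have Pflat n := projective_flat (@res_projective _ _ P n).
have aflat := flat_image_surj (@res_aug_surj _ _ P) Mflat.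
have dflat n : flat_image (res_d P n).
  elim: n => [|n IH]; first exact: flat_image_step (@res_exact0 _ _ P) (Pflat _)
    aflat.
  exact: flat_image_step (@res_exact _ _ P n) (Pflat _) IH.
case=> [|n]; first exact: flat_image_exact gP (@res_exact _ _ P 0) (@res_exact0
  _ _ P) aflat.
exact: flat_image_exact gP (@res_exact _ _ P n.+1) (@res_exact _ _ P n) (dflat
  n).
Qed.

End TorVanishing.

(** * Noetherian modules *)

(** The Noetherian condition in its maximal form; abstracting over [adm] lets it serve both ideals
    and submodules. *)
Definition max_cond (T : Type) (adm : (T -> Prop) -> Prop) : Prop :=
  forall Fam : (T -> Prop) -> Prop,
    (forall U, Fam U -> adm U) -> (exists U, Fam U) ->
  exists U, Fam U /\
    forall V, Fam V -> (forall x, U x -> V x) -> forall x, V x -> U x.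

Definition submodule (R : pzRingType) (M : lmodType R) (U : M -> Prop) : Prop :=
  [/\ U 0, forall x y, U x -> U y -> U (x + y) & forall a x, U x -> U (a *: x)].

Section Submodule.
Variables (R : pzRingType) (M : lmodType R) (U : M -> Prop).
Hypothesis Usub : submodule U.

Lemma submodN x : U x -> U (- x).
Proof. by case: Usub => _ _ UZ Ux; rewrite -scaleN1r; apply: UZ. Qed.

Lemma submodB x y : U x -> U y -> U (x - y).
Proof. by case: (Usub) => _ UD _ Ux Uy; apply/UD/submodN. Qed.

Lemma submod_sum (T : Type) (s : seq T) (P : pred T) (F : T -> M) :
  (forall t, U (F t)) -> U (\sum_(t <- s | P t) F t).
Proof. by case: (Usub) => U0 UD _ UF; elim/big_ind: _. Qed.

End Submodule.

Lemma ideal_sum (R : comPzRingType) (I : R -> Prop) : is_ideal I ->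
  forall (T : Type) (s : seq T) (F : T -> R),
  (forall t, I (F t)) -> I (\sum_(t <- s) F t).
Proof. by case=> I0 ID _ T s F IF; elim/big_ind: _. Qed.


(** Without a maximal member, choice yields a strictly ascending sequence; finitely many generators
    of its union already lie in one term. *)
Lemma noetherian_max (R : comPzRingType) :
  noetherian R -> max_cond (@is_ideal R).
Proof.
move=> noethR Fam FamI [U0 FU0]; apply: contrapT => /forallNP nomax.
have /choice[next nextP] (U : {U | Fam U}) : exists V : {V | Fam V},
    (forall x, sval U x -> sval V x) /\ ~ (forall x, sval V x -> sval U x).
  case: U => U FU /=; apply: contrapT => /forallNP H; apply: (nomax U);
    split=> //.
  move=> V FV UV; apply: contrapT => VU.
  by apply: (H (exist _ V FV)).
pose u n := iter n next (exist _ U0 FU0).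
have u_mono m n : (m <= n)%N -> forall x, sval (u m) x -> sval (u n) x.
  elim: n => [|n IH]; first by rewrite leqn0 => /eqP->.
  rewrite leq_eqVlt => /orP[/eqP->//|/IH umn x /umn].
  by case: (nextP (u n)) => + _; apply.
have Iideal : is_ideal (fun x => exists n, sval (u n) x).
  have uI n : is_ideal (sval (u n)) by case: (u n) => /= V /FamI.
  split; first by exists 0; case: (uI 0).
    move=> x y [m um] [n un]; exists (maxn m n);
      case: (uI (maxn m n)) => _ UD _.
    by apply: UD; [apply: u_mono um | apply: u_mono un];
      rewrite ?leq_maxl ?leq_maxr.
  by move=> a x [n un]; exists n; case: (uI n) => _ _; apply.
have [k [g gP]] := noethR _ Iideal.
have /choice[n nP] i : exists n, sval (u n) (g i).
  by apply/gP; exists (fun j => (j == i)%:R); rewrite (bigD1 i) //= eqxx mul1r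
     big1 ?addr0 // => j /negPf->; rewrite mul0r.
pose N := \max_i n i.
case: (nextP (u N)) => _; apply => x xN.
have /gP[c ->] : exists n, sval (u n) x by exists N.+1.
have uI : is_ideal (sval (u N)) by case: (u N) => /= V /FamI.
apply: (ideal_sum uI) => i; case: (uI) => _ _; apply.
by apply: u_mono (nP i); apply: leq_bigmax.
Qed.

Section FiniteModule.
Variables (R : comPzRingType) (M : lmodType R).

Fixpoint span (s : seq M) : M -> Prop :=
  if s is g :: s' then fun x => exists a y, span s' y /\ x = a *: g + y
  else fun x => x = 0.

Lemma span_submodule s : submodule (span s).
Proof.
elim: s => [|g s [s0 sD sZ]] /=.
  by split=> // [x y -> ->|a x ->]; rewrite ?addr0 ?scaler0.
split.
- by exists 0, 0; rewrite scale0r addr0.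
- move=> _ _ [a [y [sy ->]]] [b [z [sz ->]]]; exists (a + b), (y + z).
  by split; [apply: sD | rewrite scalerDl addrACA].
- move=> b _ [a [y [sy ->]]]; exists (b * a), (b *: y).
  by split; [apply: sZ | rewrite scalerDr scalerA].
Qed.

Lemma span_sum (T : Type) (g : T -> M) (c : T -> R) (s : seq T) :
  span (map g s) (\sum_(t <- s) c t *: g t).
Proof.
elim: s => [|t s IH]; first by rewrite big_nil.
by rewrite big_cons; exists (c t), (\sum_(t <- s) c t *: g t).
Qed.

(** A submodule is determined, among those containing it, by its ideal of leading coefficients along
    [g] and its intersection with [span s]. The family is maximised first for the former, then for
    the latter among the members whose leading ideal contains the maximal one. *)
Lemma span_max s : noetherian R ->
  max_cond (fun U : M -> Prop => submodule U /\ forall x, U x -> span s x).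
Proof.
move=> noethR; elim: s => [|g s IH] Fam Fsub [L FL].
  exists L; split=> // V /Fsub[_ V0] _ x /V0 /= ->.
  by case: (Fsub _ FL) => -[].
have [s0 sD sZ] := span_submodule s.
pose lead (U : M -> Prop) a := exists y, span s y /\ U (a *: g + y).
have leadI U : submodule U -> is_ideal (lead U).
  move=> [U0 UD UZ]; split.
  - by exists 0; rewrite scale0r addr0.
  - move=> a b [y [sy Uy]] [z [sz Uz]]; exists (y + z); split; first exact: sD.
    by rewrite scalerDl addrACA; apply: UD.
  - move=> a b [y [sy Uy]]; exists (a *: y); split; first exact: sZ.
    by rewrite -scalerA -scalerDr; apply: UZ.
have [||_ [[L0 [FL0 ->]] L0max]] :=
    noetherian_max noethR (Fam := fun J => exists U, Fam U /\ J = lead U).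
- by move=> _ [U [/Fsub[Us _] ->]]; apply: leadI.
- by exists (lead L), L.
have [||_ [[L1 [FL1 [L01 ->]]] L1max]] := IH (fun W => exists U, Fam U /\
    (forall a, lead L0 a -> lead U a) /\ W = (fun y => U y /\ span s y)).
- move=> _ [U [/Fsub[[U0 UD UZ] _] [_ ->]]]; split=> [|x []//].
  split=> // [x y [Ux sx] [Uy sy]|a x [Ux sx]]; split;
    by [apply: UD | apply: sD|apply: UZ|apply: sZ].
- by exists (fun y => L0 y /\ span s y), L0.
exists L1; split=> // V FV L1V x Vx.
have [Vsub Vspan] := Fsub _ FV; have [a [y [sy xE]]] := Vspan _ Vx.
have leadV b : lead L1 b -> lead V b by case=> z [sz /L1V]; exists z.
have [z [sz L1z]] : lead L1 a.
  apply/L01/(L0max (lead V)); first by exists V.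
    by move=> b /L01/leadV.
  by exists y; rewrite -xE.
have [L1yz _] : L1 (y - z) /\ span s (y - z).
  apply: (L1max (fun y => V y /\ span s y)).
  - by exists V; split=> //; split=> // b /L01/leadV.
  - by move=> w [/L1V].
  - split; last exact: (submodB (span_submodule s)).
    have -> : y - z = x - (a *: g + z) by rewrite xE opprD addrACA subrr add0r.
    by apply: submodB Vsub _ _ _ _ => //; apply: L1V.
case: (Fsub _ FL1) => -[_ L1D _] _.
have -> : x = (a *: g + z) + (y - z) by rewrite xE -addrA [z + _]addrC subrK.
exact: L1D.
Qed.

Lemma finite_max (I : finType) (g : I -> M) : noetherian R ->
  (forall x, exists c : I -> R, x = \sum_i c i *: g i) ->
  max_cond (@submodule R M).
Proof.
move=> noethR gP Fam Fsub; apply: (span_max (s := map g (index_enum I)) noethR).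
move=> U /Fsub Usub; split=> // x _; have [c ->] := gP x.
exact: span_sum.
Qed.

(* Weak form of both the Artin-Rees lemma and Krull's intersection theorem: [Q]
   is maximal among the submodules [Q] such that [U <= Q] and [Q n V <= U]. *)
Lemma separating_submodule (I : finType) (a : I -> R) (U V : M ->
  Prop) (j : nat) :
  max_cond (@submodule R M) -> submodule U -> submodule V ->
  (forall x, U x -> V x) -> (forall i x, V x -> U (a i ^+ j *: x)) ->
  exists (k : nat) (Q : M -> Prop), [/\ submodule Q, forall x, U x -> Q x,
    forall x, V x -> Q x -> U x & forall i x, Q (a i ^+ k *: x)].
Proof.
move=> maxM Usub Vsub UV aVU.
have [||Q [[Qsub UQ QVU] Qmax]] := maxM (fun Q => [/\ submodule Q,
    forall x, U x -> Q x & forall x, V x -> Q x -> U x]).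
- by move=> Q [].
- by exists U.
have [Q0 QD QZ] := Qsub; have [V0 VD VZ] := Vsub; have [U0 UD UZ] := Usub.
have /choice[k kP] i : exists k, forall x, Q (a i ^+ k *: x).
  (* The ascending chain of colon submodules (Q : a_i^n) stops growing at [k]. *)
  pose C n x := Q (a i ^+ n *: x).
  have Cmono m n x : (m <= n)%N -> C m x -> C n x.
    by move=> /subnK<- Cx; rewrite /C exprD -scalerA; apply: QZ.
  have [||_ [[k ->] kmax]] := maxM (fun W => exists n, W = C n).
  - move=> _ [n ->]; split=> [|x y|b x]; rewrite /C ?scaler0 //.
      by rewrite scalerDr; apply: QD.
    by rewrite scalerA mulrC -scalerA; apply: QZ.
  - by exists (C 0), 0.
  (* The submodule a_i^k M + Q still meets [V] inside [U], so maximality puts it in [Q]. Indeed, for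
     y = a_i^k x + q in [V], a_i^j y lies in [U], so a_i^(j+k) x lies in [Q], and then so does a_i^k
     x by the choice of [k]. *)
  exists k => x0; apply: (Qmax (fun y => exists x q,
    Q q /\ y = a i ^+ k *: x + q)).
  - split.
    + split; first by exists 0, 0; rewrite scaler0 addr0.
        move=> _ _ [x [q [Qq ->]]] [y [r [Qr ->]]]; exists (x + y), (q + r).
        by split; [apply: QD | rewrite scalerDr addrACA].
      move=> b _ [x [q [Qq ->]]]; exists (b *: x), (b *: q).
      by split; [apply: QZ | rewrite scalerDr !scalerA mulrC].
    + by move=> x /UQ Qx; exists 0, x; rewrite scaler0 add0r.
    + move=> y Vy [x [q [Qq yE]]]; apply: QVU => //; rewrite yE;
        apply: QD => //.
      apply: (kmax (C (j + k))); [by exists (j + k)%N| |].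
        by move=> z; apply: Cmono; rewrite leq_addl.
      have -> : C (j + k)%N x = Q (a i ^+ j *: (y - q)).
        by rewrite /C yE addrK scalerA -exprD.
      by rewrite scalerBr; apply: (submodB Qsub); [apply/UQ/aVU | apply: QZ].
  - by move=> x Qx; exists 0, x; rewrite scaler0 add0r.
  - by exists x0, 0; rewrite addr0.
exists (\max_i k i), Q; split=> // i x.
have /subnK<- : (k i <= \max_i k i)%N by apply: leq_bigmax.
by rewrite addnC exprD -scalerA.
Qed.

End FiniteModule.

Definition prime_ideal (R : comPzRingType) (P : R -> Prop) : Prop :=
  [/\ is_ideal P, ~ P 1 & forall x y, P (x * y) -> P x \/ P y].

Lemma maximal_ideal_exists (R : comPzRingType) (J : R -> Prop) :
  noetherian R -> is_ideal J -> ~ J 1 ->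
  exists P, prime_ideal P /\ forall x, J x -> P x.
Proof.
move=> noethR JI J1.
have [||P [[PI P1 JP] Pmax]] := noetherian_max noethR
  (Fam := fun P => [/\ is_ideal P, ~ P 1 & forall x, J x -> P x]).
- by move=> P [].
- by exists J.
exists P; split=> //; split=> // x y Pxy.
have [P0 PD PM] := PI.
case: (pselect (P x)) => [|nPx]; [by left | right].
have [z [t [Pz zt]]] : exists z t, P z /\ 1 = z + t * x.
  apply: contrapT => no; apply: nPx.
  apply: (Pmax (fun u => exists z t, P z /\ u = z + t * x)).
  - split.
    + split; first by exists 0, 0; rewrite mul0r addr0.
        move=> _ _ [z [t [Pz ->]]] [z' [t' [Pz' ->]]];
          exists (z + z'), (t + t').
        by split; [apply: PD | ring].
      move=> a _ [z [t [Pz ->]]]; exists (a * z), (a * t).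
      by split; [apply: PM | ring].
    + by [].
    + by move=> u /JP Pu; exists u, 0; rewrite mul0r addr0.
  - by move=> u Pu; exists u, 0; rewrite mul0r addr0.
  - by exists 0, 1; rewrite mul1r add0r.
rewrite -[y]mul1r zt mulrDl; apply: PD; first by rewrite mulrC; apply: PM.
by rewrite -mulrA; apply: PM.
Qed.

Lemma prime_idealX (R : comPzRingType) (P : R -> Prop) x n :
  prime_ideal P -> ~ P x -> ~ P (x ^+ n).
Proof.
case=> _ P1 PM Px; elim: n => [|n IH]; first by rewrite expr0.
by rewrite exprS => /PM[].
Qed.

(** * Flatness *)

Section FlatnessUpTo.
Variables (R : comPzRingType) (M : lmodType R).

(* The relations of [M] come from relations of [R] modulo the ideal [a], after
   multiplication by an element of the multiplicative set [D]. *)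
Definition flat_upto (D a : R -> Prop) : Prop :=
  forall (I : finType) (c : I -> R) (v : I -> M), \sum_i c i *: v i = 0 ->
  exists2 d, D d & mspan (fun k => a (\sum_i c i * k i)) (fun i => d *: v i).

Lemma sum_delta (I : finType) (v : I -> M) i :
  \sum_j ((i == j)%:R : R) *: v j = v i.
Proof.
rewrite (bigD1 i) //= eqxx scale1r big1 ?addr0 // => j.
by rewrite eq_sym => /negPf->; rewrite scale0r.
Qed.

(** The equations are solved one after another. Substituting the combinations of [u] for d v in the
    next equation gives one relation between the [u], which is solved in turn. Denominators
    multiply, and earlier congruences survive because [a] is an ideal. *)
Lemma flat_upto_system (D a : R -> Prop) :
  D 1 -> (forall x y, D x -> D y -> D (x * y)) -> is_ideal a -> flat_upto D a ->
  forall (I X : finType) (A : X -> I -> R) (v : I -> M),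
    (forall x, \sum_i A x i *: v i = 0) ->
  exists2 d, D d &
    mspan (fun k => forall x, a (\sum_i A x i * k i)) (fun i => d *: v i).
Proof.
move=> D1 DM aI flatM I X A v Av.
have : forall s : seq X, exists2 d, D d &
    mspan (fun k => forall x, x \in s -> a (\sum_i A x i * k i)) (fun i => d *:
      v i).
  elim=> [|x s [d Dd [L [k [u [Kk vE]]]]]].
    exists 1 => //; exists I, (fun j i => (i == j)%:R), v; split=> // i.
    by rewrite scale1r sum_delta.
  have /flatM[d' Dd' [H [k' [u' [Kk' uE]]]]] :
      \sum_l (\sum_i A x i * k l i) *: u l = 0.
    under eq_bigr do rewrite scaler_suml.
    rewrite exchange_big /=.
    under eq_bigr do under eq_bigr do rewrite -scalerA.
    under eq_bigr do rewrite -scaler_sumr -vE scalerA mulrC -scalerA.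
    by rewrite -scaler_sumr Av scaler0.
  exists (d' * d); first exact: DM.
  exists H, (fun h i => \sum_l k l i * k' h l), u'.
  have swap h y : \sum_i A y i * (\sum_l k l i * k' h l) =
      \sum_l (\sum_i A y i * k l i) * k' h l.
    under eq_bigr do rewrite mulr_sumr.
    rewrite exchange_big; apply: eq_bigr => l _.
    by rewrite mulr_suml; apply: eq_bigr => i _; rewrite mulrA.
  split=> [h y|i].
    rewrite swap inE => /predU1P[-> //|ys]; apply: ideal_sum => // l.
    by case: aI => _ _ aM; rewrite mulrC; apply/aM/Kk.
  rewrite -scalerA vE scaler_sumr.
  under eq_bigr do rewrite scalerA mulrC -scalerA uE scaler_sumr.
  rewrite exchange_big; apply: eq_bigr => h _.
  by rewrite scaler_suml; apply: eq_bigr => l _; rewrite scalerA.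
move=> /(_ (enum X))[d Dd Kv]; exists d => //.
by apply: mspan_mono Kv => k Kk x; apply: Kk; rewrite mem_enum.
Qed.

Lemma flat_upto_eq :
  flat_upto (fun d => d = 1) (fun x => x = 0) -> equationally_flat M.
Proof.
move=> flatM I X A v Av.
have [] := flat_upto_system _ _ _ flatM Av; rewrite //.
- by move=> _ _ -> ->; rewrite mulr1.
- by split=> // [_ _ -> ->|b _ ->]; rewrite ?addr0 ?mulr0.
move=> _ ->; apply: mspan_ext => i; exact: scale1r.
Qed.

(** One linear equation over the fraction field of R / P: a coefficient [c i0] outside [P] is the
    pivot and the denominator. If all coefficients lie in [P], every vector is a solution modulo
    [P]. *)
Lemma flat_upto_prime (P : R -> Prop) : prime_ideal P ->
  flat_upto (fun d => ~ P d) P.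
Proof.
move=> [PI P1 PM] I c v cv.
case: (pselect (forall i, P (c i))) => [Pc|/existsNP[i0 Pc]].
  exists 1 => //; exists I, (fun j i => (i == j)%:R), v.
  split=> [l|i]; last by rewrite scale1r sum_delta.
  apply: ideal_sum => // i; rewrite mulrC.
  by case: PI => _ _; apply.
exists (c i0) => //.
exists I, (fun j i => c i0 * (i == j)%:R - c j * (i == i0)%:R), v.
have [P0 _ _] := PI.
split=> [j|i].
  have -> // : \sum_i c i * (c i0 * (i == j)%:R - c j * (i == i0)%:R) = 0.
  under eq_bigr do rewrite mulrBr.
  rewrite sumrB (bigD1 j) //= eqxx [X in _ + X - _]big1 ?addr0; last first.
    by move=> i /negPf->; rewrite !mulr0.
  rewrite (bigD1 i0) //= eqxx [X in _ - (_ + X)]big1 ?addr0; last first.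
    by move=> i /negPf->; rewrite !mulr0.
  by rewrite !mulr1 mulrC subrr.
under eq_bigr do rewrite scalerBl -scalerA mulrC -scalerA.
by rewrite sumrB -!scaler_sumr cv scaler0 subr0 sum_delta.
Qed.

End FlatnessUpTo.

(** * Frobenius powers of ideals *)

Section FrobeniusPowers.
Variables (p : nat) (p_pr : prime p) (R : comPzRingType) (pR0 : p%:R = 0 :> R).

Lemma frobE (x : R) : frobenius p_pr pR0 x = x ^+ p.
Proof. by []. Qed.

Lemma exprp_sum (T : Type) (s : seq T) (F : T -> R) :
  (\sum_(t <- s) F t) ^+ p = \sum_(t <- s) F t ^+ p.
Proof. by rewrite -frobE rmorph_sum. Qed.

Lemma exprpD (x y : R) : (x + y) ^+ p = x ^+ p + y ^+ p.
Proof. by rewrite -!frobE rmorphD. Qed.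

Lemma exprpN (x : R) : (- x) ^+ p = - x ^+ p.
Proof. by rewrite -!frobE rmorphN. Qed.

Lemma exprp_exp_sum e (T : Type) (s : seq T) (F : T -> R) :
  (\sum_(t <- s) F t) ^+ (p ^ e) = \sum_(t <- s) F t ^+ (p ^ e).
Proof.
elim: e => [|e IH]; first by rewrite expn0 expr1;
  under [RHS]eq_bigr do rewrite expr1.
by rewrite expnSr exprM IH exprp_sum; apply: eq_bigr => t _; rewrite exprM.
Qed.

Definition frob_power (P : R -> Prop) (q : nat) : R -> Prop := fun x =>
  exists (L : finType) (c a : L -> R),
    (forall l, P (a l)) /\ x = \sum_l c l * a l ^+ q.

Lemma frob_power_ideal (P : R -> Prop) q : is_ideal (frob_power P q).
Proof.
split.
- exists void, (fun=> 0), (fun=> 0); split; first by case.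
  by rewrite big1 // => -[].
- move=> _ _ [L [c [a [Pa ->]]]] [L' [c' [a' [Pa' ->]]]].
  exists (L + L')%type, (fun l => match l with inl a => c a | inr b => c' b
    end),
    (fun l => match l with inl b => a b | inr b => a' b end).
  by split=> [[]//|]; rewrite big_sumType.
- move=> b _ [L [c [a [Pa ->]]]]; exists L, (fun l => b * c l), a; split=> //.
  by rewrite mulr_sumr; under eq_bigr do rewrite mulrA.
Qed.

Lemma frob_powerX (P : R -> Prop) q x : P x -> frob_power P q (x ^+ q).
Proof.
move=> Px; exists unit, (fun=> 1), (fun=> x); split=> //.
by rewrite (big_pred1 tt) ?mul1r // => -[].
Qed.

Lemma frob_power_exprp (P : R -> Prop) q x :
  frob_power P q x -> frob_power P (q * p) (x ^+ p).
Proof.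
case=> L [c [a [Pa ->]]]; exists L, (fun l => c l ^+ p), a; split=> //.
by rewrite exprp_sum; apply: eq_bigr => l _; rewrite exprMn exprM.
Qed.

(** The iterated Frobenius is additive, so the p^e-th powers of generators of [P] generate the
    Frobenius power. *)
Lemma frob_power_gen (P : R -> Prop) e (I : finType) (g : I -> R) (Q : R ->
  Prop) :
  (forall x, P x -> exists c : I -> R, x = \sum_i c i * g i) ->
  is_ideal Q -> (forall i, Q (g i ^+ (p ^ e))) ->
  forall x, frob_power P (p ^ e) x -> Q x.
Proof.
move=> gP QI Qg _ [L [c [a [Pa ->]]]]; apply: ideal_sum => // l.
have [b ->] := gP _ (Pa l); rewrite exprp_exp_sum; case: (QI) => _ _ QM.
by apply: (QM); apply: (ideal_sum QI) => i; rewrite exprMn; apply: QM.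
Qed.

End FrobeniusPowers.

(** * Flatness from a bijective relative Frobenius *)

Section FlatRelFrobenius.
Variables (p : nat) (p_pr : prime p) (R S : comPzRingType).
Variables (pR0 : p%:R = 0 :> R) (pS0 : p%:R = 0 :> S) (f : {rmorphism R -> S}).
Hypotheses (noethR : noetherian R) (noethS : noetherian S).
Hypothesis finR : F_finite p_pr pR0.
Local Notation relF := (@rel_frobenius p p_pr R S pR0 pS0 f).
Hypothesis bijF : bijective relF.

Local Notation SR := (restr S^o f).
Local Notation FR := (restr R^o (frobenius p_pr pR0)).

Lemma rel_frobenius_sum (I : finType) (y : I -> SR) (r : I -> FR) :
  relF (\sum_i tens (y i) (r i)) =
  \sum_i (y i : S) ^+ p * f (r i).
Proof. exact: tens_lift_sum (rel_frobenius_balanced p_pr pR0 pS0 f). Qed.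

(** The relative Frobenius turns a relation in [S] into a linear system on the coordinates [y] of
    [v]. The hypothesis solves it modulo P^[q]; p-th powers of that solution solve the given
    relation modulo P^[qp]. *)
Lemma flat_upto_frob_power (P : R -> Prop) (q : nat) : prime_ideal P ->
  flat_upto SR (fun d => ~ P d) (frob_power P q) ->
  flat_upto SR (fun d => ~ P d) (frob_power P (q * p)).
Proof.
move=> Pprime flatq I c v cv.
have [PI P1 PM] := Pprime.
have [n [g gP]] := finR.
have gP' (r : FR) : exists b : 'I_n -> R, r = \sum_i b i *: (g i : FR).
  by have [b bE] := gP r; exists b.
have [G _ GK] := bijF.
pose vS : I -> S := v.
have cvS : \sum_i f (c i) * vS i = 0 by exact: cv.
have /choice[y vE] i : exists y : 'I_n -> S, vS i = \sum_j y j ^+ p * f (g j).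
  have [y yE] := tensor_gen gP' (G (vS i)).
  by exists y; rewrite -[LHS]GK yE rel_frobenius_sum.
have /choice[b bE] (x : I * 'I_n) : exists b : 'I_n -> R,
    c x.1 * g x.2 = \sum_j b j ^+ p * g j.
  exact: gP.
(* Expanding each c_i g_j in the generators shows that the relative Frobenius sends this tensor to
   the given relation; injectivity makes it zero. *)
have /(tens_sum_eq0 gP')[L [r [z [Kr wE]]]] :
    \sum_j tens (\sum_x b x j *: (y x.1 x.2 : SR)) (g j : FR) = 0.
  apply: (bij_inj bijF); rewrite rel_frobenius_sum.
  rewrite [RHS](tens_lift0 (rel_frobenius_balanced p_pr pR0 pS0 f)).
  rewrite -[RHS]cvS; symmetry.
  transitivity (\sum_i \sum_j (y i j ^+ p * f (c i * g j))).
    apply: eq_bigr => i _; rewrite vE mulr_sumr.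
    by apply: eq_bigr => j _; rewrite rmorphM mulrCA.
  rewrite pair_big /=.
  under eq_bigr => x _ do rewrite bE rmorph_sum mulr_sumr.
  rewrite exchange_big /=; apply: eq_bigr => j _.
  rewrite (exprp_sum p_pr pS0) mulr_suml; apply: eq_bigr => x _.
  by rewrite [_ *: _]/(f (b x j) * y x.1 x.2) exprMn rmorphM rmorphXn mulrA [_ *
    f _ ^+ _]mulrC.
(* The unknowns are the coordinates [y] and the auxiliary [z]; moving the relations [r] to the left
   makes the system homogeneous. *)
pose A (j : 'I_n) (x : I * 'I_n + L) : R :=
  match x with inl x => b x j | inr l => - r l j end.
pose yz (x : I * 'I_n + L) : SR :=
  match x with inl x => y x.1 x.2 | inr l => z l end.
have Ayz j : \sum_x A j x *: yz x = 0.
  rewrite big_sumType /= wE.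
  by under [X in _ + X]eq_bigr do rewrite scaleNr; rewrite sumrN subrr.
have [] := flat_upto_system _ _ _ flatq Ayz => // [x x' Px Px'|/=|].
  by case/PM.
  exact: frob_power_ideal.
move=> d Pd [H [k [u [Kk dE]]]].
exists (d ^+ p); first exact: prime_idealX.
exists H, (fun h i => \sum_j k h (inl (i, j)) ^+ p * g j),
  (fun h => (u h : S) ^+ p).
split=> [h|i].
  have -> : \sum_i c i * (\sum_j k h (inl (i, j)) ^+ p * g j) =
      \sum_j (\sum_x A j x * k h x) ^+ p * g j.
    transitivity (\sum_x k h (inl x) ^+ p * (c x.1 * g x.2)).
      under eq_bigr do rewrite mulr_sumr.
      by rewrite pair_big; apply: eq_bigr => -[i j] _ /=; rewrite mulrCA.
    under eq_bigr do rewrite bE mulr_sumr.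
    rewrite exchange_big /=.
    (* The subtracted sum is zero, as each [r l] is a relation between the [g j] in F_* R; it
       completes the rows of [A]. *)
    transitivity (\sum_j (\sum_x b x j * k h (inl x)) ^+ p * g j -
        \sum_l k h (inr l) ^+ p * (\sum_j r l j ^+ p * g j)).
      rewrite [X in _ - X]big1 ?subr0 => [|l _]; last first.
        by rewrite [X in _ * X]Kr mulr0.
      apply: eq_bigr => j _; rewrite (exprp_sum p_pr pR0) mulr_suml.
      by apply: eq_bigr => x _; rewrite exprMn mulrA [_ * b _ _ ^+ _]mulrC.
    under [X in _ - X]eq_bigr do rewrite mulr_sumr.
    rewrite exchange_big -sumrB; apply: eq_bigr => j _.
    rewrite big_sumType /= (exprpD p_pr pR0) mulrDl; congr (_ + _).
    rewrite (exprp_sum p_pr pR0) mulr_suml -sumrN; apply: eq_bigr => l _.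
    by rewrite mulNr (exprpN p_pr pR0) mulNr exprMn mulrA [_ * r _ _ ^+ _]mulrC.
  apply: ideal_sum => [|j]; first exact: frob_power_ideal.
  rewrite mulrC; case: (frob_power_ideal P (q * p)) => _ _; apply.
  exact: (frob_power_exprp p_pr).
pose uS : H -> S := u.
suff dvE : f (d ^+ p) * vS i =
    \sum_h f (\sum_j k h (inl (i, j)) ^+ p * g j) * uS h ^+ p by exact: dvE.
rewrite vE mulr_sumr.
transitivity (\sum_j (\sum_h f (k h (inl (i, j))) * uS h) ^+ p * f (g j)).
  apply: eq_bigr => j _; have <- : f d * y i j = \sum_h f (k h (inl (i,
    j))) * uS h.
    exact: dE (inl (i, j)).
  by rewrite exprMn rmorphXn mulrA.
under eq_bigr do rewrite (exprp_sum p_pr pS0) mulr_suml.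
rewrite exchange_big; apply: eq_bigr => h _.
rewrite rmorph_sum mulr_suml; apply: eq_bigr => j _.
by rewrite exprMn rmorphM rmorphXn mulrAC.
Qed.

Lemma flat_upto_frob_exp (P : R -> Prop) (e : nat) : prime_ideal P ->
  flat_upto SR (fun d => ~ P d) (frob_power P (p ^ e)).
Proof.
move=> Pprime; elim: e => [|e IH]; last first.
  by rewrite expnSr; apply: flat_upto_frob_power.
move=> I c v /(flat_upto_prime Pprime)[d Pd vd]; exists d => //.
by apply: mspan_mono vd => k; rewrite expn0 => /(frob_powerX 1).
Qed.

Lemma rel_frobenius_flat : equationally_flat SR.
Proof.
apply: flat_upto_eq => I c v cv; exists 1 => //.
(* The families that come from exact relations in [R]; the claim is that [v] is one of them. *)
pose L (w : I -> S^o) := mspan (M := SR) (fun k => \sum_i c i * k i = 0) w.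
have Lsub : submodule L.
  split; first exact: mspan0.
    by move=> w w' Lw Lw'; apply: mspan_ext (mspanD Lw Lw').
  move=> a w [H [k [u [Kk wE]]]]; exists H, k, (fun h => a * (u h : S));
    split=> // i.
  pose uS : H -> S := u.
  have wES : w i = \sum_h f (k h i) * uS h by exact: wE.
  suff : a * w i = \sum_h f (k h i) * (a * uS h) by [].
  by rewrite wES mulr_sumr; apply: eq_bigr => h _; rewrite mulrCA.
suff : L v by apply: mspan_ext => i; rewrite scale1r.
have [L0 LD LZ] := Lsub.
pose vS : I -> S^o := v.
(* The annihilator of [v] modulo [L]: if [v] is not in [L], this ideal is proper and lies in a prime
   [m]. *)
pose J s := L (s *: vS).
have JI : is_ideal J.
  split=> [|s t Js Jt|s t Jt]; rewrite /J ?scale0r //.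
    by rewrite scalerDl; apply: LD.
  by rewrite -scalerA; apply: LZ.
apply: contrapT => nLv.
have [|m [mprime Jm]] := maximal_ideal_exists noethS JI;
  first by rewrite /J scale1r.
pose P (r : R) := m (f r).
have [[m0 mD mM] m1 mprod] := mprime.
have Pprime : prime_ideal P.
  split; last by move=> x y; rewrite /P rmorphM; apply: mprod.
    split=> [|x y|a x]; rewrite /P ?rmorph0 //; first by rewrite rmorphD;
      apply: mD.
    by rewrite rmorphM; apply: mM.
  by rewrite /P rmorph1.
have [PI _ _] := Pprime.
have [n [g gP]] := noethR PI.
have Pg i : P (g i).
  apply/gP; exists (fun j => (j == i)%:R); rewrite (bigD1 i) //= eqxx mul1r.
  by rewrite big1 ?addr0 // => j /negPf->; rewrite mul0r.
have p_gt1 := prime_gt1 p_pr.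
(* Krull's intersection theorem in [S^I] modulo [L], along [m] *)
pose V (w : I -> S^o) := exists s : S, L (w - s *: vS).
pose U (w : I -> S^o) := exists s : S, m s /\ L (w - s *: vS).
have diffD w w' s s' : (w + w') - (s + s') *: vS = (w - s *: vS) + (w' - s' *:
  vS).
  by rewrite scalerDl opprD addrACA.
have diffZ a w s : a *: w - (a * s) *: vS = a *: (w - s *: vS).
  by rewrite scalerBr scalerA.
have Vsub : submodule V.
  split; first by exists 0; rewrite scale0r subr0.
    by move=> w w' [s Ls] [s' Ls']; exists (s + s'); rewrite diffD; apply: LD.
  by move=> a w [s Ls]; exists (a * s); rewrite diffZ; apply: LZ.
have Usub : submodule U.
  split; first by exists 0; rewrite scale0r subr0.
    move=> w w' [s [ms Ls]] [s' [ms' Ls']]; exists (s + s').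
    by rewrite diffD; split; [apply: mD | apply: LD].
  by move=> a w [s [ms Ls]]; exists (a * s); rewrite diffZ; split;
    [apply: mM|apply: LZ].
have maxSI : max_cond (@submodule S (I -> S^o)).
  apply: (finite_max (g := fun j i => (i == j)%:R : S^o) noethS) => w.
  exists w; apply/funext => i; rewrite fct_sumE (bigD1 i) //= big1 => [|j /negPf
    ji].
    by rewrite scalrfctE eqxx addr0 [RHS]mulr1.
  by rewrite scalrfctE eq_sym ji scaler0.
(* Here V = S v + L and U = m v + L. The generators of [P] map into [m] and carry [V] into [U] at
   once, whence the exponent 1. *)
have [||k0 [Q [Qsub UQ QVU gQ]]] :=
    separating_submodule (a := fun i => f (g i)) (j := 1) maxSI Usub Vsub.
- by move=> w [s [_ Ls]]; exists s.
- move=> i w [s Ls]; exists (f (g i) * s); rewrite expr1 diffZ.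
  by split; [rewrite mulrC; apply/mM/Pg | apply: LZ].
(* the Artin-Rees lemma for the ideal generated by [c] *)
pose V' (r : R^o) := exists k : I -> R, r = \sum_i c i * k i.
pose U' (r : R^o) := exists k : I -> R,
  (forall i, frob_power P (p ^ k0) (k i)) /\ r = \sum_i c i * k i.
have [fp0 fpD fpM] := frob_power_ideal P (p ^ k0).
have V'sub : submodule V'.
  split; first by exists (fun=> 0); rewrite big1 // => i _; rewrite mulr0.
    move=> _ _ [k ->] [k' ->]; exists (fun i => k i + k' i).
    by rewrite -big_split; apply: eq_bigr => i _; rewrite mulrDr.
  move=> a _ [k ->]; exists (fun i => a * k i).
  by rewrite [LHS]mulr_sumr; apply: eq_bigr => i _; rewrite mulrCA.
have U'sub : submodule U'.
  split; first by exists (fun=> 0); split=> //; rewrite big1 // => i _;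
    rewrite mulr0.
    move=> _ _ [k [Pk ->]] [k' [Pk' ->]]; exists (fun i => k i + k' i).
    split=> [i|]; first exact: fpD.
    by rewrite -big_split; apply: eq_bigr => i _; rewrite mulrDr.
  move=> a _ [k [Pk ->]]; exists (fun i => a * k i); split=> [i|];
    first exact: fpM.
  by rewrite [LHS]mulr_sumr; apply: eq_bigr => i _; rewrite mulrCA.
have maxR : max_cond (@submodule R R^o).
  apply: (finite_max (g := fun _ : unit => 1 : R^o) noethR) => r.
  by exists (fun=> r); rewrite (big_pred1 tt) ?[RHS]mulr1 // => -[].
(* [U'] is the product of [V'] with P^[p^k0], so the p^k0-th powers of the generators carry [V']
   into [U']. *)
have [||k1 [Q' [Q'sub _ Q'VU gQ']]] :=
    separating_submodule (a := g) (j := p ^ k0) maxR U'sub V'sub.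
- by move=> r [k [_ ->]]; exists k.
- move=> i _ [k ->]; exists (fun j => g i ^+ (p ^ k0) * k j); split=> [j|].
    by rewrite mulrC; apply/fpM/frob_powerX.
  by rewrite [LHS]mulr_sumr; apply: eq_bigr => j _; rewrite mulrCA.
have [d Pd [H [k [u [Kk dvE]]]]] := flat_upto_frob_exp k1 Pprime cv.
(* Since p^k1 >= k1, P^[p^k1] lies in [Q'], so the defect of [k h] lies in [U']. Subtracting [k'],
   with entries in P^[p^k0], leaves an exact relation. *)
have /choice[k' k'P] h : exists k' : I -> R,
    (forall i, frob_power P (p ^ k0) (k' i)) /\
    \sum_i c i * (k h i - k' i) = 0.
  have [k' [Pk' kE]] : U' (\sum_i c i * k h i).
    apply: Q'VU; first by exists (k h).
    apply: (frob_power_gen p_pr pR0 (g := g) (e := k1) (Q := Q')) (Kk h) => //.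
      by move=> x /gP.
    move=> i; have -> : g i ^+ (p ^ k1) = g i ^+ k1 * g i ^+ (p ^ k1 - k1).
      by rewrite -exprD subnKC // ltnW // ltn_expl.
    exact: gQ'.
  exists k'; split=> //; under eq_bigr do rewrite mulrBr.
  by rewrite sumrB kE subrr.
have [Q0 QD QZ] := Qsub.
have Qfp r : frob_power P (p ^ k0) r -> forall w, Q (f r *: w).
  pose I' r := forall w, Q (f r *: w).
  apply: (frob_power_gen p_pr pR0 (g := g) (Q := I')) => [x /gP|| i w] //.
    split=> [w|x y Ix Iy w|a x Ix w].
    - by rewrite rmorph0 scale0r.
    - by rewrite rmorphD scalerDl; apply: QD.
    - by rewrite rmorphM -scalerA; apply: QZ.
  have /subnKC<- : (k0 <= p ^ k0)%N by rewrite ltnW // ltn_expl.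
  by rewrite exprD rmorphM rmorphXn mulrC -scalerA; apply/QZ/gQ.
(* The exact relations k - k' contribute [w1] in [L]; the entries of [k'] carry all of S^I into [Q],
   which gives [w2]. *)
have Qdv : Q (f d *: vS).
  pose w1 (i : I) : S^o := \sum_h f (k h i - k' h i) * (u h : S).
  pose w2 (i : I) : S^o := \sum_h f (k' h i) * (u h : S).
  have -> : f d *: vS = w1 + w2.
    apply/funext => i; rewrite addrfctE /w1 /w2 -big_split.
    have dvS : f d * (vS i : S) = \sum_h f (k h i) * (u h : S) by exact: dvE.
    rewrite scalrfctE [LHS]dvS; apply: eq_bigr => h _.
    by rewrite rmorphB /= mulrBl subrK.
  apply: QD.
    apply: UQ; exists 0; split=> //; rewrite scale0r subr0.
    by exists H, (fun h i => k h i - k' h i), u; split=> // h; have [] := k'P h.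
  have -> : w2 = \sum_h \sum_i f (k' h i) *: (fun j => (j == i)%:R * (u h :
    S) : S^o).
    apply/funext => i; rewrite fct_sumE; apply: eq_bigr => h _.
    rewrite fct_sumE (bigD1 i) //= big1 => [|j /negPf ji].
      by rewrite addr0 scalrfctE eqxx mul1r.
    by rewrite scalrfctE eq_sym ji mul0r scaler0.
  apply: submod_sum => // h; apply: submod_sum => // i.
  by apply: Qfp; have [] := k'P h.
(* Then f d - s annihilates [v] modulo [L], so it lies in [m]; with [s] in [m] this contradicts the
   choice of [d] outside [P]. *)
have [s [ms]] : U (f d *: vS).
  by apply: QVU => //; exists (f d); rewrite subrr.
rewrite -scalerBl => /Jm mds; apply: Pd.
by rewrite /P -[f d](subrK s); apply: mD.
Qed.

End FlatRelFrobenius.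

(** * Tensor product and quotient rings *)

Section TensorRing.
Variables (A B C : comPzRingType) (f : {rmorphism A ->
  B}) (g : {rmorphism A -> C}).
Local Notation BA := (restr B^o f).
Local Notation CA := (restr C^o g).

Definition tring : Type := tensor BA CA.
HB.instance Definition _ := GRing.Zmodule.on tring.

Definition tmul (b : B) (c : C) : tring := tens (b : BA) (c : CA).

Lemma tmulDl b b' c : tmul (b + b') c = tmul b c + tmul b' c.
Proof. by case: (tens_balanced BA CA) => tD _ _; exact: tD. Qed.

Lemma tmulDr b c c' : tmul b (c + c') = tmul b c + tmul b c'.
Proof. by case: (tens_balanced BA CA) => _ tD _; exact: tD. Qed.

Lemma tmulA a b c : tmul (f a * b) c = tmul b (g a * c).
Proof. by case: (tens_balanced BA CA) => _ _ tZ; exact: tZ. Qed.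

Lemma tring_ind (P : tring -> Prop) :
  P 0 -> (forall x y, P x -> P y -> P (x + y)) -> (forall b c, P (tmul b c)) ->
  forall x, P x.
Proof. exact: tensor_ind. Qed.

(** Multiplication by one pure tensor; a second lift, in the pair (b, c), gives the product of the
    ring. *)
Definition tring_lmul (b : B) (c : C) : tring -> tring :=
  tens_lift (fun (b' : BA) (c' : CA) => tmul (b * b') (c * c')).

Lemma tring_lmul_balanced b c :
  balanced (fun (b' : BA) (c' : CA) => tmul (b * b') (c * c')).
Proof.
split=> [b1 b2 c1|b1 c1 c2|a b1 c1]; rewrite ?mulrDr ?tmulDl ?tmulDr //.
rewrite -[LHS]/(tmul (b * (f a * b1)) (c * c1)).
rewrite -[RHS]/(tmul (b * b1) (c * (g a * c1))).
by rewrite [b * (_ * _)]mulrCA [c * (_ * _)]mulrCA tmulA.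
Qed.

Lemma tring_lmulE b c b' c' : tring_lmul b c (tmul b' c') = tmul (b * b') (c *
  c').
Proof. exact: tens_lift_tens (tring_lmul_balanced b c). Qed.

Lemma tring_lmulD b c x y : tring_lmul b c (x + y) = tring_lmul b c x +
  tring_lmul b c y.
Proof. exact: tens_liftD (tring_lmul_balanced b c) x y. Qed.

Lemma tring_lmul0 b c : tring_lmul b c 0 = 0.
Proof. exact: tens_lift0 (tring_lmul_balanced b c). Qed.

Lemma tring_mul_balanced y : balanced (fun (b : BA) (c :
  CA) => tring_lmul b c y).
Proof.
split=> [b b' c|b c c'|a b c]; elim/tring_ind: y => [|y z IHy IHz|d e];
  rewrite ?tring_lmul0 ?addr0 // ?tring_lmulD ?IHy ?IHz // 1?addrACA //
    !tring_lmulE.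
- by rewrite mulrDl tmulDl.
- by rewrite mulrDl tmulDr.
- by rewrite -[LHS]/(tmul (f a * b * d) (c * e)) -mulrA tmulA mulrA.
Qed.

Definition tring_mul (x y : tring) : tring :=
  tens_lift (fun (b : BA) (c : CA) => tring_lmul b c y) x.

Lemma tring_mulE b c b' c' :
  tring_mul (tmul b c) (tmul b' c') = tmul (b * b') (c * c').
Proof. by rewrite [LHS](tens_lift_tens _ _ (tring_mul_balanced _)) tring_lmulE.
  Qed.

Fact tring_mulDl : left_distributive tring_mul +%R.
Proof. by move=> x y z; apply: tens_liftD (tring_mul_balanced z) x y. Qed.

Lemma tring_mul0l x : tring_mul 0 x = 0.
Proof. exact: tens_lift0 (tring_mul_balanced x). Qed.

Lemma tring_mulDr : right_distributive tring_mul +%R.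
Proof.
move=> x y z; elim/tring_ind: x => [|x x' IH IH'|b c].
- by rewrite !tring_mul0l addr0.
- by rewrite !tring_mulDl IH IH' addrACA.
by rewrite /tring_mul !(tens_lift_tens _ _ (tring_mul_balanced _)) tring_lmulD.
Qed.

Lemma tring_mul0r x : tring_mul x 0 = 0.
Proof. by apply: (addrI (tring_mul x 0)); rewrite -tring_mulDr !addr0. Qed.

Fact tring_mulC : commutative tring_mul.
Proof.
move=> x y; elim/tring_ind: x => [|x x' IH IH'|b c].
- by rewrite tring_mul0l tring_mul0r.
- by rewrite tring_mulDl tring_mulDr IH IH'.
elim/tring_ind: y => [|y y' IH IH'|b' c'].
- by rewrite tring_mul0l tring_mul0r.
- by rewrite tring_mulDl tring_mulDr IH IH'.
by rewrite !tring_mulE mulrC [c * _]mulrC.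
Qed.

Fact tring_mulA : associative tring_mul.
Proof.
move=> x y z; elim/tring_ind: x => [|x x' IH IH'|b c].
- by rewrite !tring_mul0l.
- by rewrite !tring_mulDl IH IH'.
elim/tring_ind: y => [|y y' IH IH'|b' c'].
- by rewrite tring_mul0r !tring_mul0l tring_mul0r.
- by rewrite tring_mulDr !tring_mulDl tring_mulDr IH IH'.
elim/tring_ind: z => [|z z' IH IH'|b'' c''].
- by rewrite !tring_mul0r.
- by rewrite !tring_mulDr IH IH'.
by rewrite !tring_mulE !mulrA.
Qed.

Fact tring_mul1 : left_id (tmul 1 1) tring_mul.
Proof.
elim/tring_ind=> [|x y IHx IHy|b c].
- by rewrite tring_mul0r.
- by rewrite tring_mulDr IHx IHy.
by rewrite tring_mulE !mul1r.
Qed.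

HB.instance Definition _ := GRing.Zmodule_isComPzRing.Build tring
  tring_mulA tring_mulC tring_mul1 tring_mulDl.

Lemma tmulM b c b' c' : tmul b c * tmul b' c' = tmul (b * b') (c * c').
Proof. exact: tring_mulE. Qed.

Lemma tmulX b c n : tmul b c ^+ n = tmul (b ^+ n) (c ^+ n).
Proof. by elim: n => [//|n IH]; rewrite !exprS IH tmulM. Qed.

Definition tinl (b : B) : tring := tmul b 1.
Definition tinr (c : C) : tring := tmul 1 c.

Fact tinl_nmod : nmod_morphism tinl.
Proof. by split=> [|x y]; [exact: tens0l | exact: tmulDl]. Qed.
Fact tinl_monoid : monoid_morphism tinl.
Proof. by split=> // x y; rewrite /tinl tmulM mulr1. Qed.
HB.instance Definition _ := GRing.isNmodMorphism.Build B tring tinl tinl_nmod.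
HB.instance Definition _ := GRing.isMonoidMorphism.Build B tring tinl
  tinl_monoid.

Fact tinr_nmod : nmod_morphism tinr.
Proof. by split=> [|x y]; [exact: tens0r | exact: tmulDr]. Qed.
Fact tinr_monoid : monoid_morphism tinr.
Proof. by split=> // x y; rewrite /tinr tmulM mulr1. Qed.
HB.instance Definition _ := GRing.isNmodMorphism.Build C tring tinr tinr_nmod.
HB.instance Definition _ := GRing.isMonoidMorphism.Build C tring tinr
  tinr_monoid.

Lemma tinlr a : tinl (f a) = tinr (g a).
Proof. by rewrite /tinl -[f a]mulr1 tmulA mulr1. Qed.

Lemma tmulE b c : tmul b c = tinl b * tinr c.
Proof. by rewrite tmulM mul1r mulr1. Qed.

Section Lift.
Variables (D : comPzRingType) (u : {rmorphism B -> D}) (v : {rmorphism C -> D}).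

(** Taking the compatibility proof as an argument lets the morphism structures below be inferred
    from the term. *)
Definition tring_lift of u \o f =1 v \o g : tring -> D :=
  tens_lift (fun (b : BA) (c : CA) => u b * v c).

Hypothesis uv : u \o f =1 v \o g.

Lemma tring_lift_balanced : balanced (fun (b : BA) (c : CA) => u b * v c).
Proof.
split=> [b b' c|b c c'|a b c]; rewrite ?raddfD ?mulrDl ?mulrDr //.
suff : u (f a * b) * v c = u b * v (g a * c) by [].
have uva : u (f a) = v (g a) by exact: uv.
by rewrite !rmorphM uva -mulrA mulrCA.
Qed.

Lemma tring_liftE b c : tring_lift uv (tmul b c) = u b * v c.
Proof. exact: tens_lift_tens tring_lift_balanced. Qed.

Fact tring_lift_nmod : nmod_morphism (tring_lift uv).
Proof.
by split; [exact: tens_lift0 tring_lift_balanced | exact: tens_liftD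
  tring_lift_balanced].
Qed.
HB.instance Definition _ :=
  GRing.isNmodMorphism.Build tring D (tring_lift uv) tring_lift_nmod.

Fact tring_lift_monoid : monoid_morphism (tring_lift uv).
Proof.
split=> [|x y]; first by rewrite [LHS]tring_liftE !rmorph1 mulr1.
elim/tring_ind: x => [|x x' IH IH'|b c].
- by rewrite !(mul0r, raddf0).
- by rewrite mulrDl !raddfD /= IH IH' mulrDl.
elim/tring_ind: y => [|y y' IH IH'|b' c'].
- by rewrite !(mulr0, raddf0).
- by rewrite mulrDr !raddfD /= IH IH' mulrDr.
by rewrite tmulM !tring_liftE !rmorphM mulrACA.
Qed.
HB.instance Definition _ :=
  GRing.isMonoidMorphism.Build tring D (tring_lift uv) tring_lift_monoid.

Lemma tring_lift_inl b : tring_lift uv (tinl b) = u b.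
Proof. by rewrite tring_liftE rmorph1 mulr1. Qed.

Lemma tring_lift_inr c : tring_lift uv (tinr c) = v c.
Proof. by rewrite tring_liftE rmorph1 mul1r. Qed.

End Lift.

(** Base change keeps finiteness: the 1 (x) h_i generate the tensor product over [B], and its ideals
    are [B]-submodules. *)
Lemma tring_max : noetherian B -> finite_rmorphism g ->
  max_cond (@is_ideal tring).
Proof.
move=> noethB [n [h hP]].
have genT (x : restr tring^o tinl) :
    exists c : 'I_n -> B, x = \sum_i c i *: (tinr (h i) : restr tring^o tinl).
  have hP' (c : CA) : exists a : 'I_n -> A, c = \sum_i a i *: (h i : CA).
    by have [a aE] := hP c; exists a.
  have [z zE] := tensor_gen hP' (x : tring); exists z; rewrite [LHS]zE.
  by apply: eq_bigr => i _; exact: tmulE (z i) (h i).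
move=> Fam FamI FamN; apply: (finite_max noethB genT) => // U /FamI[U0 UD UM].
by split=> // b x; apply: UM.
Qed.

End TensorRing.

(** * Quotient by an ideal *)

Section QuotientRing.
Variables (R : comPzRingType) (I : R -> Prop) (idI : is_ideal I).
Local Open Scope quotient_scope.

Definition ideal_eq : rel R := fun x y => `[< I (x - y) >].

Fact ideal_eq_refl : reflexive ideal_eq.
Proof. by move=> x; apply/asboolP; rewrite subrr; case: idI. Qed.
Fact ideal_eq_sym : symmetric ideal_eq.
Proof.
have sub x y : ideal_eq x y -> ideal_eq y x.
  move=> /asboolP Ixy; apply/asboolP; case: (idI) => _ _ IM.
  by rewrite -opprB -mulN1r; apply: IM.
by move=> x y; apply/idP/idP => /sub.
Qed.
Fact ideal_eq_trans : transitive ideal_eq.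
Proof.
move=> y x z /asboolP Ixy /asboolP Iyz; apply/asboolP; case: (idI) => _ ID _.
by rewrite -(subrK y x) -addrA; apply: ID.
Qed.

Canonical ideal_equiv := EquivRel ideal_eq ideal_eq_refl ideal_eq_sym
  ideal_eq_trans.

Definition qring : Type := {eq_quot ideal_equiv}.
Local Notation Q := qring.
HB.instance Definition _ := Choice.on Q.
HB.instance Definition _ := EqQuotient.on Q.

Definition qproj (x : R) : Q := \pi_Q x.

Lemma qproj_eq x y : qproj x = qproj y <-> I (x - y).
Proof. by split=> [/eqmodP/asboolP|Ixy]; [|apply/eqmodP/asboolP]. Qed.

Lemma qprojP (x : Q) : exists y, qproj y = x.
Proof. by exists (repr x); apply: reprK. Qed.

Lemma qrepr x : I (repr (qproj x) - x).
Proof. by apply/qproj_eq; apply: reprK. Qed.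

Definition qring_add (x y : Q) : Q := qproj (repr x + repr y).
Definition qring_opp (x : Q) : Q := qproj (- repr x).
Definition qring_mul (x y : Q) : Q := qproj (repr x * repr y).

Lemma qprojD x y : qring_add (qproj x) (qproj y) = qproj (x + y).
Proof.
apply/qproj_eq; rewrite opprD addrACA; case: (idI) => _ ID _.
by apply: ID; apply: qrepr.
Qed.

Lemma qprojN x : qring_opp (qproj x) = qproj (- x).
Proof.
apply/qproj_eq; rewrite opprK addrC -opprB -mulN1r; case: (idI) => _ _ IM.
by apply/IM/qrepr.
Qed.

Lemma qprojM x y : qring_mul (qproj x) (qproj y) = qproj (x * y).
Proof.
apply/qproj_eq; case: (idI) => _ ID IM.
set x' := repr _; set y' := repr _.
have -> : x' * y' - x * y = y' * (x' - x) + x * (y' - y) by ring.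
by apply: ID; apply/IM/qrepr.
Qed.

Lemma qringW (P : Q -> Prop) : (forall x, P (qproj x)) -> forall x, P x.
Proof. by move=> Pq x; have [y <-] := qprojP x. Qed.

Fact qring_addA : associative qring_add.
Proof. by elim/qringW=> x; elim/qringW=> y; elim/qringW=> z;
  rewrite !qprojD addrA. Qed.
Fact qring_addC : commutative qring_add.
Proof. by elim/qringW=> x; elim/qringW=> y; rewrite !qprojD addrC. Qed.
Fact qring_add0 : left_id (qproj 0) qring_add.
Proof. by elim/qringW=> x; rewrite !qprojD add0r. Qed.
Fact qring_addN : left_inverse (qproj 0) qring_opp qring_add.
Proof. by elim/qringW=> x; rewrite !(qprojN, qprojD) addNr. Qed.
HB.instance Definition _ := GRing.isZmodule.Build Q
  qring_addA qring_addC qring_add0 qring_addN.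

Fact qring_mulA : associative qring_mul.
Proof. by elim/qringW=> x; elim/qringW=> y; elim/qringW=> z;
  rewrite !qprojM mulrA. Qed.
Fact qring_mulC : commutative qring_mul.
Proof. by elim/qringW=> x; elim/qringW=> y; rewrite !qprojM mulrC. Qed.
Fact qring_mul1 : left_id (qproj 1) qring_mul.
Proof. by elim/qringW=> x; rewrite !qprojM mul1r. Qed.
Fact qring_mulDl : left_distributive qring_mul qring_add.
Proof.
by elim/qringW=> x; elim/qringW=> y; elim/qringW=> z;
  rewrite !(qprojM, qprojD) mulrDl.
Qed.
HB.instance Definition _ := GRing.Zmodule_isComPzRing.Build Q
  qring_mulA qring_mulC qring_mul1 qring_mulDl.

Fact qproj_nmod : nmod_morphism qproj.
Proof. by split=> // x y; rewrite -qprojD. Qed.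
Fact qproj_monoid : monoid_morphism qproj.
Proof. by split=> // x y; rewrite -qprojM. Qed.
HB.instance Definition _ := GRing.isNmodMorphism.Build R Q qproj qproj_nmod.
HB.instance Definition _ := GRing.isMonoidMorphism.Build R Q qproj qproj_monoid.

Lemma qproj_eq0 x : qproj x = 0 <-> I x.
Proof. by rewrite -[X in I X]subr0; apply: qproj_eq. Qed.

Section Descent.
Variables (D : comPzRingType) (u : {rmorphism R -> D}).

Definition qring_lift of (forall x, I x -> u x = 0) : Q -> D :=
  fun x => u (repr x).
Hypothesis uI : forall x, I x -> u x = 0.

Lemma qring_liftE x : qring_lift uI (qproj x) = u x.
Proof.
by apply/eqP; rewrite -subr_eq0 -raddfB; apply/eqP/uI/qrepr.
Qed.

Fact qring_lift_nmod : nmod_morphism (qring_lift uI).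
Proof.
split; first by rewrite [LHS]qring_liftE rmorph0.
elim/qringW=> x; elim/qringW=> y.
by rewrite -rmorphD !qring_liftE rmorphD.
Qed.
Fact qring_lift_monoid : monoid_morphism (qring_lift uI).
Proof.
split; first by rewrite [LHS]qring_liftE rmorph1.
elim/qringW=> x; elim/qringW=> y.
by rewrite -rmorphM !qring_liftE rmorphM.
Qed.
HB.instance Definition _ := GRing.isNmodMorphism.Build Q D (qring_lift uI)
  qring_lift_nmod.
HB.instance Definition _ := GRing.isMonoidMorphism.Build Q D (qring_lift uI)
  qring_lift_monoid.

End Descent.

End QuotientRing.

(** * Formally etale maps *)

Lemma tring_ext (A B C D : comPzRingType) (f : {rmorphism A -> B})
    (g : {rmorphism A -> C}) (u v : {rmorphism tring f g -> D}) :
  u \o @tinl _ _ _ f g =1 v \o @tinl _ _ _ f g ->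
  u \o @tinr _ _ _ f g =1 v \o @tinr _ _ _ f g -> u =1 v.
Proof.
move=> uvl uvr; elim/tring_ind=> [|x y uvx uvy|b c].
- by rewrite !rmorph0.
- by rewrite !rmorphD uvx uvy.
by rewrite tmulE !rmorphM [u _](uvl b) [u _](uvr c).
Qed.

Lemma rmorphism_inverse (A B : comPzRingType) (h : {rmorphism A -> B}) :
  bijective h -> exists k : {rmorphism B -> A}, cancel h k /\ cancel k h.
Proof.
case=> k hK kK.
have kD : nmod_morphism k by exact: can2_nmod_morphism hK kK.
have kM : monoid_morphism k by exact: can2_monoid_morphism hK kK.
pose kA := GRing.isNmodMorphism.Build B A k kD.
pose kR := GRing.isMonoidMorphism.Build B A k kM.
by exists (HB.pack_for {rmorphism B -> A} k kA kR).
Qed.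

(** * Idempotent nil ideals *)

Section ProductIdeal.
Variables (R : comPzRingType) (J : R -> Prop).
Hypothesis JI : is_ideal J.

Definition ideal_square : R -> Prop := fun x =>
  exists (L : finType) (a b : L -> R),
    (forall l, J (a l) /\ J (b l)) /\ x = \sum_l a l * b l.

Lemma ideal_square_ideal : is_ideal ideal_square.
Proof.
split.
- exists void, (fun=> 0), (fun=> 0); split; first by case.
  by rewrite big1 // => -[].
- move=> _ _ [L [a [b [Jab ->]]]] [L' [a' [b' [Jab' ->]]]].
  exists (L + L')%type, (fun l => match l with inl l => a l | inr l => a' l
    end),
    (fun l => match l with inl l => b l | inr l => b' l end).
  by split=> [[]//|]; rewrite big_sumType.
- move=> c _ [L [a [b [Jab ->]]]]; exists L, (fun l => c * a l), b; split.
    by move=> l; have [Ja Jb] := Jab l; split=> //; case: JI => _ _; apply.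
  by rewrite mulr_sumr; under eq_bigr do rewrite mulrA.
Qed.

Lemma ideal_squareM x y : J x -> J y -> ideal_square (x * y).
Proof.
move=> Jx Jy; exists unit, (fun=> x), (fun=> y); split=> //.
by rewrite (big_pred1 tt) // => -[].
Qed.

(* Take [Q] maximal among the ideals that do not contain [J].  If [h] in [J] is
   not in [Q], and [h ^+ k] is its last power outside [Q], then
   [J <= Q + (h ^+ k)], so that [h J <= Q]; hence [J <= J^2 <= Q]. *)
Lemma idempotent_nil_ideal n : max_cond (@is_ideal R) ->
  (forall x, J x -> ideal_square x) -> (forall x, J x -> x ^+ n = 0) ->
  forall x, J x -> x = 0.
Proof.
move=> maxR JJ Jnil x0 Jx0; apply: contrapT => x0n0.
have [||Q [[QI nJQ] Qmax]] := maxR (fun Q => is_ideal Q /\ ~ forall x,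
  J x -> Q x).
- by move=> Q [].
- exists (fun x => x = 0); split; last by move=> /(_ _ Jx0).
  by split=> // [_ _ -> ->|a _ ->]; rewrite ?addr0 ?mulr0.
have [Q0 QD QM] := QI.
apply: nJQ => x /JJ[L [a [b [Jab ->]]]]; apply: ideal_sum => // l.
have [Ja Jb] := Jab l.
case: (pselect (Q (a l))) => [Qa|nQa]; first by rewrite mulrC; apply: QM.
have [k [nQk Qk]] : exists k, ~ Q (a l ^+ k) /\ Q (a l ^+ k.+1).
  have : Q (a l ^+ n) by rewrite Jnil.
  elim: n {Jnil} => [Q1|n IH Qn].
    by case: nQa; rewrite -[a l]mulr1; apply: QM; rewrite -(expr0 (a l)).
  by case: (pselect (Q (a l ^+ n))) => [/IH//|nQn]; exists n.
pose Q' y := exists q t, Q q /\ y = q + t * a l ^+ k.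
have [q [t [Qq ->]]] : Q' (b l).
  apply: contrapT => nQ'b; apply: nQk; apply: (Qmax Q').
  - split; last by move=> /(_ _ Jb).
    split; first by exists 0, 0; rewrite mul0r addr0.
      move=> _ _ [q [t [Qq ->]]] [q' [t' [Qq' ->]]]; exists (q + q'), (t + t').
      by split; [apply: QD | rewrite mulrDl addrACA].
    move=> c _ [q [t [Qq ->]]]; exists (c * q), (c * t).
    by split; [apply: QM | rewrite mulrDr mulrA].
  - by move=> q Qq; exists q, 0; rewrite mul0r addr0.
  - by exists 0, 1; rewrite mul1r add0r.
rewrite mulrDr mulrCA -exprS.
by apply: QD; apply: QM.
Qed.

End ProductIdeal.

Lemma formally_etale_unique (R S B C : comPzRingType) (f : {rmorphism R -> S})
    (q : {rmorphism B -> C}) (v w : {rmorphism S -> B}) : formally_etale f ->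
  (forall c, exists x, q x = c) ->
  (forall x y, q x = 0 -> q y = 0 -> x * y = 0) ->
  v \o f =1 w \o f -> q \o v =1 q \o w -> v =1 w.
Proof.
move=> etf q_surj q_sq0 vwf qvw s.
have [|x [_ _ xP]] := etf B C (v \o f) q (q \o v) q_surj q_sq0 => //.
by rewrite (xP v) // (xP w) // => r; rewrite /= -?[w _]vwf -?[q (w _)]qvw.
Qed.

(** * The thickening by the square of a kernel *)

Section SquareOfKernel.
Variables (T D : comPzRingType) (m : {rmorphism T -> D}).
Hypothesis m_surj : forall y, exists x, m x = y.

Definition kernel (x : T) : Prop := m x = 0.

Lemma kernel_ideal : is_ideal kernel.
Proof.
split=> [|x y mx my|a x mx]; rewrite /kernel ?rmorph0 //.
  by rewrite rmorphD mx my addr0.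
by rewrite rmorphM mx mulr0.
Qed.

Definition kernel_square_ideal := ideal_square_ideal kernel_ideal.
Local Notation Q := (qring kernel_square_ideal).

Lemma kernel_square0 x : ideal_square kernel x -> m x = 0.
Proof.
case=> L [a [b [ab ->]]]; rewrite rmorph_sum big1 // => l _.
by rewrite rmorphM (proj1 (ab l)) mul0r.
Qed.

Definition square_proj : {rmorphism T -> Q} := qproj kernel_square_ideal.
Definition square_thickening : {rmorphism Q -> D} :=
  qring_lift (idI := kernel_square_ideal) kernel_square0.

Lemma square_thickeningE x : square_thickening (square_proj x) = m x.
Proof. exact: qring_liftE. Qed.

Lemma square_proj_eq0 x : square_proj x = 0 -> ideal_square kernel x.
Proof. by move/qproj_eq0. Qed.

Lemma square_thickening_surj y : exists x, square_thickening x = y.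
Proof.
by have [x <-] := m_surj y; exists (square_proj x); rewrite square_thickeningE.
Qed.

Lemma square_thickening_sq0 x y :
  square_thickening x = 0 -> square_thickening y = 0 -> x * y = 0.
Proof.
have [x' <-] := qprojP x; have [y' <-] := qprojP y.
rewrite !square_thickeningE => mx my.
rewrite -[LHS](rmorphM square_proj); apply/qproj_eq0.
exact: ideal_squareM.
Qed.

End SquareOfKernel.

Section FrobeniusDescent.
Variables (p : nat) (p_pr : prime p) (B C : comPzRingType) (pB0 :
  p%:R = 0 :> B).
Variable q : {rmorphism B -> C}.
Hypothesis q_surj : forall c, exists x, q x = c.
Hypothesis q_sq0 : forall x y, q x = 0 -> q y = 0 -> x * y = 0.

(* The Frobenius of [B] kills the kernel of [q]. *)
Lemma frobenius_descent : exists phi : {rmorphism C -> B},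
  forall x, phi (q x) = x ^+ p.
Proof.
have [s sP] := choice q_surj.
pose phi c := s c ^+ p.
have phiE x : phi (q x) = x ^+ p.
  apply/eqP; rewrite -subr_eq0 -(exprpN p_pr pB0) -(exprpD p_pr pB0).
  have q0 : q (s (q x) - x) = 0 by rewrite rmorphB /= sP subrr.
  have sq0 : (s (q x) - x) ^+ 2 = 0 by rewrite expr2 q_sq0.
  by rewrite -(subnKC (prime_gt1 p_pr)) exprD sq0 mul0r.
have phiD : nmod_morphism phi.
  split=> [|c d]; first by rewrite -(rmorph0 q) phiE expr0n eqn0Ngt prime_gt0.
  by rewrite -[c]sP -[d]sP -rmorphD !phiE (exprpD p_pr pB0).
have phiM : monoid_morphism phi.
  split=> [|c d]; first by rewrite -(rmorph1 q) phiE expr1n.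
  by rewrite -[c]sP -[d]sP -rmorphM !phiE exprMn.
pose phiA := GRing.isNmodMorphism.Build C B phi phiD.
pose phiR := GRing.isMonoidMorphism.Build C B phi phiM.
by exists (HB.pack_for {rmorphism C -> B} phi phiA phiR).
Qed.

End FrobeniusDescent.

(* If [1 \in H < S] is a maximal proper [A]-submodule, [s0 \notin H] and
   [m = (H : s0)], then [s |-> alpha s] with [s - alpha s *: s0 \in H] is a map
   [S -> A / m], and [s (x) t |-> alpha s * t] sends [s0 (x) 1] to [1] and
   [1 (x) s0] to [0] in [S / m S].  Hence [1 \in m S], and [1 = 1 ^+ p \in m].
     *)
Lemma finite_epi_surj (p : nat) (p_pr : prime p) (A S : comPzRingType)
    (pS0 : p%:R = 0 :> S) (h : {rmorphism A -> S}) :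
  noetherian S -> F_finite p_pr pS0 -> (forall s, exists a, h a = s ^+ p) ->
  (forall s, tinl h h s = tinr h h s) -> forall s, exists a, h a = s.
Proof.
move=> noethS [n [g gP]] hpow epi s1; apply: contrapT => ns1.
pose MF := restr S^o (frobenius p_pr pS0).
pose Asub (H : S -> Prop) := [/\ H 1, forall x y, H x -> H y -> H (x + y),
  forall a x, H x -> H (h a * x) & exists s, ~ H s].
(* [S] is a finite module over itself along Frobenius. As [h] hits all p-th powers, [A]-submodules
   of [S] are submodules for this structure. *)
have maxS : max_cond (@submodule S MF).
  apply: (finite_max (g := (g : 'I_n -> MF)) noethS) => s.
  by have [c cE] := gP s; exists c.
have [||H [[H1 HD HA [s0 nHs0]] Hmax]] := maxS Asub.
- move=> U [U1 UD UA _]; split=> // [|s x Ux].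
    by have := UA 0 1 U1; rewrite rmorph0 mul0r.
  have [a aE] := hpow s; have := UA a x Ux.
  by rewrite aE.
- exists (fun s => exists a, h a = s); split; last by exists s1.
  + by exists 1; rewrite rmorph1.
  + by move=> _ _ [a <-] [b <-]; exists (a + b); rewrite rmorphD.
  + by move=> a _ [b <-]; exists (a * b); rewrite rmorphM.
have HB x y : H x -> H y -> H (x - y).
  by move=> Hx Hy; apply: HD => //; rewrite -mulN1r -(rmorph1 h) -rmorphN;
    apply: HA.
(* By maximality of [H], the [A]-submodule H + h(A) s0 is all of [S]. *)
have /choice[alpha alphaP] s : exists a, H (s - h a * s0).
  apply: contrapT => /forallNP nHs; apply: nHs0.
  apply: (Hmax (fun x => exists y a, H y /\ x = y + h a * s0)).
  - split; last first.
    + exists s => -[y [a [Hy sE]]]; apply: (nHs a).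
      by rewrite sE addrK.
    + move=> a _ [y [b [Hy ->]]]; exists (h a * y), (a * b).
      by split; [apply: HA | rewrite mulrDr rmorphM mulrA].
    + move=> _ _ [y [a [Hy ->]]] [z [b [Hz ->]]]; exists (y + z), (a + b).
      by split; [apply: HD | rewrite rmorphD mulrDl addrACA].
    + by exists 1, 0; rewrite rmorph0 mul0r addr0.
  - by move=> y Hy; exists y, 0; rewrite rmorph0 mul0r addr0.
  - by exists 0, 1; rewrite rmorph1 mul1r add0r -(subrr 1); split=> //;
      apply: HB.
pose K x := exists (L : finType) (a : L -> A) (t : L -> S),
  (forall l, H (h (a l) * s0)) /\ x = \sum_l h (a l) * t l.
have KI : is_ideal K.
  split.
  - exists void, (fun=> 0), (fun=> 0); split; first by case.
    by rewrite big1 // => -[].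
  - move=> _ _ [L [a [t [Ha ->]]]] [L' [a' [t' [Ha' ->]]]].
    exists (L + L')%type, (fun l => match l with inl l => a l | inr l => a' l
      end),
      (fun l => match l with inl l => t l | inr l => t' l end).
    by split=> [[]//|]; rewrite big_sumType.
  - move=> c _ [L [a [t [Ha ->]]]]; exists L, a, (fun l => c * t l); split=> //.
    by rewrite mulr_sumr; apply: eq_bigr => l _; rewrite mulrCA.
have Kgen a t : H (h a * s0) -> K (h a * t).
  move=> Ha; exists unit, (fun=> a), (fun=> t); split=> //.
  by rewrite (big_pred1 tt) // => -[].
pose b (s t : S) : qring KI := qproj KI (h (alpha s) * t).
have bal : balanced (b : restr S^o h -> restr S^o h -> qring KI).
  split=> [s s' t|s t t'|a s t].
  - rewrite /b -rmorphD -mulrDl -rmorphD; apply/qproj_eq.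
    rewrite -mulrBl -rmorphB; apply: Kgen.
    rewrite rmorphB rmorphD.
    have -> : (h (alpha (s + s')) - (h (alpha s) + h (alpha s'))) * s0 =
        ((s - h (alpha s) * s0) + (s' - h (alpha s') * s0)) -
        ((s + s') - h (alpha (s + s')) * s0) by ring.
    by apply: HB => //; apply: HD.
  - by rewrite /b -rmorphD -mulrDr.
  - have -> : b (a *: s) t = b (h a * s) t by [].
    have -> : b s (a *: t) = b s (h a * t) by [].
    rewrite /b mulrA -rmorphM; apply/qproj_eq.
    rewrite -mulrBl -rmorphB; apply: Kgen.
    rewrite rmorphB rmorphM.
    have -> : (h (alpha (h a * s)) - h (alpha s) * h a) * s0 =
        h a * (s - h (alpha s) * s0) - (h a * s - h (alpha (h a * s)) * s0) by
          ring.
    by apply: HB => //; apply: HA.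
have bE : b s0 1 = b 1 s0.
  have := congr1 (tens_lift (b : restr S^o h -> restr S^o h ->
    qring KI)) (epi s0).
  by rewrite ![tens_lift _ _](tens_lift_tens _ _ bal).
have [L [a [t [Ha E1]]]] : K 1.
  apply/(qproj_eq0 KI).
  have b1 : b 1 s0 = 0.
    apply/qproj_eq0; apply: Kgen.
    have -> : h (alpha 1) * s0 = 1 - (1 - h (alpha 1) * s0) by ring.
    exact: HB.
  rewrite -b1 -bE; apply/qproj_eq; rewrite mulr1 -(rmorph1 h) -rmorphB -[h
    _]mulr1.
  apply: Kgen; rewrite rmorphB rmorph1 mulrBl mul1r.
  exact: alphaP.
apply: nHs0; rewrite -[s0]mul1r -(expr1n _ p) E1 (exprp_sum p_pr pS0) mulr_suml.
have H0 : H 0 by rewrite -(subrr 1); apply: HB.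
elim/big_ind: _ => // l _.
have [c cE] := hpow (t l).
(* One of the [p] factors [a l] is kept aside to carry [s0] into [H]. *)
have -> : (h (a l) * t l) ^+ p * s0 = h (a l ^+ p.-1 * c) * (h (a l) * s0).
  rewrite exprMn -cE -{1}(prednK (prime_gt0 p_pr)) exprSr rmorphM rmorphXn;
    ring.
exact: HA.
Qed.

(** * The relative Frobenius of a formally etale map *)

Section RelativeFrobenius.
Variables (p : nat) (p_pr : prime p) (R S : comPzRingType).
Variables (pR0 : p%:R = 0 :> R) (pS0 : p%:R = 0 :> S) (f : {rmorphism R -> S}).
Local Notation FR := (frobenius p_pr pR0).
Local Notation FS := (frobenius p_pr pS0).
Local Notation Sp := (tring f FR).

Fact frobenius_comm : FS \o f =1 f \o FR.
Proof. by move=> r; rewrite /= !frobE rmorphXn. Qed.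

Definition rel_frob : {rmorphism Sp -> S} := tring_lift frobenius_comm.


Lemma rel_frob_inl s : rel_frob (tinl f FR s) = s ^+ p.
Proof. exact: tring_lift_inl. Qed.

Lemma rel_frob_inr r : rel_frob (tinr f FR r) = f r.
Proof. exact: tring_lift_inr. Qed.

Lemma rel_frob_bij_formally_etale : bijective rel_frob -> formally_etale f.
Proof.
move=> /rmorphism_inverse[G [FG GF]] B C b q u q_surj q_sq0 ub.
have pB0 : p%:R = 0 :> B by rewrite -(rmorph_nat b) pR0 rmorph0.
have [phi phiE] := frobenius_descent p_pr pB0 q_surj q_sq0.
have comm : (phi \o u) \o f =1 b \o FR.
  by move=> r; rewrite /= [u _](ub r) phiE frobE rmorphXn.
pose v : {rmorphism S -> B} := tring_lift comm \o G.
exists v; split.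
- by move=> r; rewrite /= -rel_frob_inr FG tring_lift_inr.
- move=> s; rewrite -[s in RHS]GF -[LHS]/(q (tring_lift comm (G s))).
  apply: (tring_ext (u := q \o tring_lift comm) (v :=
    u \o rel_frob)) => [s'|r] /=.
    rewrite !tring_lift_inl /= frobE rmorphXn; have [x <-] := q_surj (u s').
    by rewrite phiE rmorphXn.
  by rewrite !tring_lift_inr [RHS]ub.
move=> w wf wq s; rewrite -[s in LHS]GF -[RHS]/(tring_lift comm (G s)).
apply: (tring_ext (u := w \o rel_frob) (v := tring_lift comm)) => [s'|r] /=.
  by rewrite !tring_lift_inl /= frobE rmorphXn -wq /= phiE.
by rewrite !tring_lift_inr [LHS]wf.
Qed.


Section FormallyEtale.
Hypotheses (noethS : noetherian S) (finS : F_finite p_pr pS0).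
Hypothesis etf : formally_etale f.

Lemma rel_frob_finite : finite_rmorphism rel_frob.
Proof.
have [n [g gP]] := finS; exists n, g => s; have [c ->] := gP s.
by exists (fun i => tinl f FR (c i)); apply: eq_bigr => i _;
  rewrite rel_frob_inl.
Qed.

Local Notation T := (tring rel_frob rel_frob).
Local Notation il := (tinl rel_frob rel_frob).
Local Notation ir := (tinr rel_frob rel_frob).

Lemma rel_frob_epi s : il s = ir s.
Proof.
have comm : idfun \o rel_frob =1 idfun \o rel_frob by [].
pose mu : {rmorphism T -> S} := tring_lift comm.
have mul' x : mu (il x) = x by exact: tring_lift_inl.
have mur x : mu (ir x) = x by exact: tring_lift_inr.
have mu_surj y : exists x, mu x = y by exists (il y).
have pT0 : p%:R = 0 :> T by rewrite -(rmorph_nat il) pS0 rmorph0.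
(* The two inclusions of [S] agree on [R] and modulo the kernel of [mu], hence modulo its square. *)
have lrE x : square_proj mu (il x) = square_proj mu (ir x).
  move: x; apply: (formally_etale_unique (v := square_proj mu \o il)
    (w := square_proj mu \o ir) etf (square_thickening_surj mu_surj)
    (@square_thickening_sq0 _ _ mu)) => [r|x].
    have ilr : il (f r) = ir (f r) by rewrite -rel_frob_inr tinlr.
    exact (congr1 (square_proj mu) ilr).
  by rewrite [LHS]square_thickeningE [RHS]square_thickeningE mul' mur.
(* This makes the kernel of [mu] equal to its square. *)
have projE x : square_proj mu x = square_proj mu (il (mu x)).
  elim/tring_ind: x => [|x y IHx IHy|b c]; first by rewrite !rmorph0.
    by rewrite !rmorphD IHx IHy.
  have muE : mu (il b * ir c) = b * c by rewrite [LHS]rmorphM mul' mur.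
  by rewrite tmulE muE rmorphM -lrE !rmorphM.
have expr0p (D : comPzRingType) : 0 ^+ p = 0 :> D.
  by rewrite expr0n eqn0Ngt prime_gt0.
(* The power c^p is the image of c (x) 1 and crosses the tensor sign, so b^p (x) c^p = (b c)^p (x)
   1. *)
have nil_pow x : x ^+ p = il (mu x ^+ p).
  elim/tring_ind: x => [|x y IHx IHy|b c].
  - by rewrite !rmorph0 !expr0p rmorph0.
  - by rewrite (exprpD p_pr pT0) IHx IHy [in RHS]rmorphD (exprpD p_pr pS0)
      rmorphD.
  have muE : mu (tmul rel_frob rel_frob b c) = b * c.
    by rewrite tmulE [LHS]rmorphM mul' mur.
  by rewrite tmulX tmulE -[c ^+ p]rel_frob_inl -tinlr rel_frob_inl -rmorphM
    -exprMn muE.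
have maxT : max_cond (@is_ideal T) by apply: tring_max noethS rel_frob_finite.
apply/eqP; rewrite -subr_eq0; apply/eqP.
apply: (@idempotent_nil_ideal _ (kernel mu) p maxT) => [x kx|x kx|].
- by apply: square_proj_eq0; rewrite projE [mu x]kx !rmorph0.
- by rewrite nil_pow [mu x]kx expr0p rmorph0.
by rewrite /kernel rmorphB mul' mur subrr.
Qed.

Lemma formally_etale_rel_frob_bij : F_finite p_pr pR0 -> bijective rel_frob.
Proof.
move=> finR.
have rel_frob_surj : forall s, exists x, rel_frob x = s.
  apply: (finite_epi_surj noethS finS) => [s|s]; last exact: rel_frob_epi.
  by exists (tinl f FR s); rewrite rel_frob_inl.
have pSp0 : p%:R = 0 :> Sp by rewrite -(rmorph_nat (tinl f FR)) pS0 rmorph0.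
pose k := square_proj rel_frob.
have kE x : square_thickening rel_frob (k x) = rel_frob x by exact:
  square_thickeningE.
have th_surj := square_thickening_surj rel_frob_surj.
have th_sq0 := @square_thickening_sq0 _ _ rel_frob.
(* The identity of [S] lifts to the thickening, taken as an [R]-algebra through the right factor. *)
have [|v [vf vq _]] := etf (b := k \o tinr f FR) (u := idfun) th_surj th_sq0.
  by move=> r; rewrite [RHS]kE rel_frob_inr.
(* Both sides lift the Frobenius of [S], and they agree on [R] because f r (x) 1 = 1 (x) r^p. *)
have kl s : k (tinl f FR s) = v (s ^+ p).
  move: s; apply: (formally_etale_unique (v := k \o tinl f FR) (w := v \o FS)
    etf th_surj th_sq0) => [r|s].
    have -> : (v \o FS \o f) r = v (f (r ^+ p)) by rewrite rmorphXn.
    by rewrite [RHS]vf [RHS]/(k (tinr f FR (FR r))) -tinlr.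
  have -> : (square_thickening rel_frob \o (v \o FS)) s = s ^+ p by exact: vq.
  by rewrite [LHS]kE; exact: rel_frob_inl.
(* The projection modulo the square of the kernel factors through [rel_frob], so the kernel equals
   its square. *)
have kv x : k x = v (rel_frob x).
  elim/tring_ind: x => [|x y IHx IHy|s r]; first by rewrite !rmorph0.
    by rewrite !rmorphD IHx IHy.
  rewrite tmulE !rmorphM kl rel_frob_inl rel_frob_inr; congr (_ * _).
  exact: esym (vf r).
(* Here r^p crosses the tensor sign as f r, so that s^p (x) r^p = s^p f(r) (x) 1. *)
have nil_pow x : x ^+ p = tinl f FR (rel_frob x).
  elim/tring_ind: x => [|x y IHx IHy|s r].
  - by rewrite !rmorph0 expr0n eqn0Ngt prime_gt0.
  - by rewrite (exprpD p_pr pSp0) IHx IHy !rmorphD.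
  have relFE' : rel_frob (tmul f FR s r) = s ^+ p * f r by exact: tring_liftE.
  by rewrite tmulX tmulE -[r ^+ p]/(FR r) -tinlr -rmorphM relFE'.
have maxSp : max_cond (@is_ideal Sp) by apply: tring_max noethS finR.
have rel_frob0 x : rel_frob x = 0 -> x = 0.
  apply: (@idempotent_nil_ideal _ (kernel rel_frob) p maxSp) => y ky.
    by apply: square_proj_eq0; rewrite [LHS]kv [rel_frob y]ky rmorph0.
  by rewrite nil_pow [rel_frob y]ky rmorph0.
have [G GK] := choice rel_frob_surj.
exists G => // x; apply/eqP; rewrite -subr_eq0; apply/eqP/rel_frob0.
by rewrite rmorphB GK subrr.
Qed.

End FormallyEtale.

End RelativeFrobenius.

Theorem theoremE (p : nat) (p_pr : prime p) (R S : comPzRingType)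
    (pR0 : p%:R = 0 :> R) (pS0 : p%:R = 0 :> S) (f : {rmorphism R -> S}) :
  noetherian R -> noetherian S -> F_finite p_pr pR0 -> F_finite p_pr pS0 ->
  relatively_perfect p_pr pR0 pS0 f <-> formally_etale f.
Proof.
move=> noethR noethS finR finS; split=> [[bijF _]|etf].
  (* The additive map [rel_frobenius] and the ring morphism [rel_frob] are convertible, which is
     used in both directions. *)
  exact: (@rel_frob_bij_formally_etale p p_pr R S pR0 pS0).
have bijF : bijective (@rel_frobenius p p_pr R S pR0 pS0 f).
  exact: (formally_etale_rel_frob_bij noethS finS etf finR).
split=> //; have [n [g gP]] := finR.
apply: (flat_tor_independent (g := (g : 'I_n ->
  restr R^o (frobenius p_pr pR0)))).
  by move=> r; have [c cE] := gP r; exists c.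
exact: rel_frobenius_flat noethR noethS finR bijF.
Qed.
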